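(* Let $k$ be a positive integer. Every $2$-connected graph $G$ of minimum degree at least $k+1$ contains $k$ cycles $C_1,\dots,C_k$ such that either (i) $|E(C_{i+1})|-|E(C_i)|=1$ for all $1\le i\le k-1$, or (ii) $|E(C_{i+1})|-|E(C_i)|=2$ for all $1\le i\le k-1$.
   Context: All graphs are finite, undirected, without loops or multiple edges. $E(H)$ denotes the edge set of a graph $H$. *)

(* Defs.v *)
From mathcomp Require Import all_boot.

Set Implicit Arguments.
Unset Strict Implicit.
Unset Printing Implicit Defensive.

Record sgraph := SGraph {
  vertex :> finType;
  adj : rel vertex;
  adj_sym : symmetric adj;
  adj_irrefl : irreflexive adj
}.

Definition degree (G : sgraph) (x : G) : nat := #|[set y | adj x y]|.

Definition min_degree_geq (G : sgraph) (d : nat) : Prop :=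
  forall x : G, d <= degree x.

Definition induced_adj (G : sgraph) (A : {set G}) : rel G :=
  [rel x y | [&& x \in A, y \in A & adj x y]].

Definition induced_connected (G : sgraph) (A : {set G}) : Prop :=
  A != set0 /\ {in A &, forall x y, connect (induced_adj A) x y}.

Definition connected_of_order (k : nat) (G : sgraph) : Prop :=
  k < #|G| /\ forall X : {set G}, #|X| < k -> induced_connected (~: X).

Definition two_connected (G : sgraph) : Prop := connected_of_order 2 G.

(* A cycle is given by its vertices in cyclic order. The size condition is
   needed because [ucycle] also accepts the empty sequence and, for an edge xy,
   the sequence [:: x; y]. *)
Definition is_cycle (G : sgraph) (c : seq G) : Prop :=
  2 < size c /\ ucycle (@adj G) c.

Definition cycle_edges (G : sgraph) (c : seq G) : {set {set G}} :=
  [set [set x; next c x] | x in c].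

Lemma cycle_edges_sub (G : sgraph) (c : seq G) :
  is_cycle c ->
  cycle_edges c \subset [set [set p.1; p.2] | p : G * G & adj p.1 p.2].
Proof.
move=> [_ /andP[cyc _]]; apply/subsetP=> _ /imsetP[x xc ->].
by apply/imsetP; exists (x, next c x); rewrite // inE /= next_cycle.
Qed.

Lemma card_cycle_edges (G : sgraph) (c : seq G) :
  is_cycle c -> #|cycle_edges c| = size c.
Proof.
move=> [c3 /andP[cyc uc]]; rewrite card_in_imset; first exact/card_uniqP.
have nn x : x \in c -> next c (next c x) <> x.
  move=> xc; case: (rot_to xc) => i p rp.
  rewrite -!(next_rot i uc) rp; move: c3 uc.
  rewrite -(size_rot i) -(rot_uniq i) rp.
  case: p {rp} => [|y [|z p]] //= _ /and3P[].
  rewrite !inE !negb_or => /and3P[xy xz _] _ _.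
  by rewrite eqxx (eq_sym y) (negbTE xy) eqxx => zx; rewrite zx eqxx in xz.
move=> x y xc yc exy; apply/eqP; apply: contraT => nxy.
have := set21 x (next c x); rewrite exy !inE (negbTE nxy) /= => /eqP ex.
have := set21 y (next c y); rewrite -exy !inE eq_sym (negbTE nxy) /= => /eqP ey.
by case: (nn x xc); rewrite -ey -ex.
Qed.

(* Main.v *)
(* Any edge xy reduces the theorem to paths: if (G, x, y) is 2-connected after
   adding xy and all other vertices have degree at least k + 1, then there are k
   paths from x to y, of at least two edges, whose lengths form an arithmetic
   progression with difference 1 or 2. Minimal counterexamples have no cut
   vertex after deleting x or y. Choose a core at x: a maximal clique containing
   x if x lies in a triangle, and otherwise a complete bipartite graph (S, T)
   with x in S and |S| <= |T|, |S| maximal. A core yields s paths of admissible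
   lengths from x to each of its outer vertices, and contracting it costs every
   other vertex at most s - 1 in degree; induction gives k - s + 1 paths through
   a block outside of the core, and the two progressions add up. The argument
   breaks down only for K_(2,t), on a block attached to x and to the second
   vertex a of S but not to T. There one pays a single unit of degree for
   ignoring a, and recovers it from two paths of admissible lengths elsewhere;
   these exist even when one vertex has small degree. *)

(* A core is useful only if some neighbour of y lies outside it, since the induction runs through a
   component of the rest that sees y. When this fails for the cores at both roots, x and y have the
   same neighbourhood; one common neighbour [t] is then set aside as the far end of all paths. A
   bipartite core raises a second obstacle: the paths may have to enter the component from only one
   of its sides, and a cut vertex of the component could hide a part that sees only the other side.
   Passing to an end block removes this, because there any nonempty set of entry vertices will do; a
   clique core has no sides and uses the whole component. The exceptional bipartite case combines
   [k - 1] paths with two, and the two need degree 3 after a loss of one; hence it assumes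
   [2 < k]. *)
Require Import Defs.
From mathcomp Require Import all_boot.
From mathcomp Require Import zify.
From Stdlib Require Import Classical.
Set Implicit Arguments.
Unset Strict Implicit.
Unset Printing Implicit Defensive.

(* Clearing the boolean hypotheses keeps [lia] from splitting on them. *)
Ltac nlia := clear; lia.

(* The clause [P a] makes k = 0 as strong as k = 1, so that a truncated
   difference of naturals can be used as the number of paths. *)
Definition admissible (k : nat) (P : nat -> Prop) : Prop :=
  exists a d : nat, [/\ d = 1 \/ d = 2, P a & forall i, i < k -> P (a + d * i)].

Lemma admissible_le (j k : nat) (P : nat -> Prop) :
  j <= k -> admissible k P -> admissible j P.
Proof.
by move=> jk [a [d [hd Pa hP]]]; exists a, d; split=> // i ij; apply/hP/(leq_trans ij).
Qed.

Lemma admissible_impl (k : nat) (P Q : nat -> Prop) (r : nat) :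
  (forall l, P l -> Q (l + r)) -> admissible k P -> admissible k Q.
Proof.
move=> PQ [a [d [hd Pa hP]]]; exists (a + r), d; split=> //; first exact: PQ.
by move=> i ik; rewrite addnAC; apply/PQ/hP.
Qed.

Lemma admissible1 (P : nat -> Prop) (l : nat) : P l -> admissible 1 P.
Proof.
by move=> Pl; exists l, 1; split=> //; [left | case=> // _; rewrite muln0 addn0].
Qed.

(** Sums of two progressions with the same difference form a progression of [m + n - 1] terms. With
    differences 1 and 2 and at least two terms on each side, single steps fill the gaps left by
    double steps, so the sums have difference 1. *)
Lemma admissible_add (m n : nat) (P Q R : nat -> Prop) :
  (forall i j, P i -> Q j -> R (i + j)) ->
  admissible m P -> admissible n Q -> admissible (m.-1 + n) R.
Proof.
move=> PQR [a [d [hd Pa hP]]] [b [c [hc Qb hQ]]].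
(* The clause [P a] supplies a first term even when [m] is 0, hence [maxn 1]. *)
have {}hP i : i < maxn 1 m -> P (a + d * i).
  by case: i => [|i]; [rewrite muln0 addn0 | move=> im; apply: hP; lia].
have {}hQ i : i < maxn 1 n -> Q (b + c * i).
  by case: i => [|i]; [rewrite muln0 addn0 | move=> im; apply: hQ; lia].
suff [g [hg H]] : exists g, (g = 1 \/ g = 2) /\
    forall i, i < m.-1 + n -> exists u v, [/\ u < maxn 1 m, v < maxn 1 n & d * u + c * v = g * i].
  exists (a + b), g; split=> //; first exact: PQR.
  move=> i /H [u [v [um vn E]]].
  by have := PQR _ _ (hP u um) (hQ v vn); congr (R _); lia.
have [m1|m1] := leqP m 1.
  by exists c; split=> // i hi; exists 0, i; split; lia.
have [n1|n1] := leqP n 1.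
  by exists d; split=> // i hi; exists i, 0; split; lia.
have [Edc|Ndc] := eqVneq d c.
  exists d; split=> // i hi; have [im|mi] := ltnP i m.
    by exists i, 0; split; lia.
  by exists m.-1, (i - m.-1); split; lia.
have [Ed|Ed] : d = 1 /\ c = 2 \/ d = 2 /\ c = 1 by lia.
  exists 1; split; first by left.
  move=> i hi; have [im|mi] := ltnP i m; first by exists i, 0; split; lia.
  (* The fewest double steps that bring the remainder below [m]; it is then [m - 2] or [m - 1],
     which makes sense as [m] exceeds 1. *)
  by exists (i - 2 * ((i - m)./2.+1)), ((i - m)./2.+1); split; lia.
exists 1; split; first by left.
move=> i hi; have [im|mi] := ltnP i n; first by exists 0, i; split; lia.
by exists ((i - n)./2.+1), (i - 2 * ((i - n)./2.+1)); split; lia.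
Qed.

(** * Walks, components and degrees *)

Section Graph.
Variables (V : finType) (e : rel V).
Hypothesis sym_e : symmetric e.
Hypothesis irr_e : irreflexive e.
Implicit Types (A B C D E F G H J O S T U W X Y Z : {set V}) (u v w x y z : V) (l k : nat).

(* The length l counts vertices, not edges. *)
Definition walk D u v l : Prop :=
  exists p, [/\ path e u p, uniq (u :: p), last u p = v,
                {subset u :: p <= D} & (size p).+1 = l].

Definition lengths D X Y l : Prop :=
  exists u v, [/\ u \in X, v \in Y & walk D u v l].

Lemma walk_sub D D' u v l : D \subset D' -> walk D u v l -> walk D' u v l.
Proof.
by move=> /subsetP sD [p [? ? ? sp ?]]; exists p; split=> // w /sp /sD.
Qed.

Lemma lengths_sub D D' X X' Y Y' l :
  D \subset D' -> X \subset X' -> Y \subset Y' ->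
  lengths D X Y l -> lengths D' X' Y' l.
Proof.
move=> sD /subsetP sX /subsetP sY [u [v [/sX uX /sY vY uv]]].
by exists u, v; split=> //; apply: walk_sub uv.
Qed.

Lemma walk1 D u : u \in D -> walk D u u 1.
Proof. by move=> uD; exists [::]; split=> // w; rewrite inE => /eqP->. Qed.

Lemma walk_in D u v l : walk D u v l -> (u \in D) * (v \in D).
Proof.
move=> [p [_ _ <- sp _]]; split; first exact/sp/mem_head.
exact/sp/mem_last.
Qed.

(** The joining edge adds no vertex, so lengths counted in vertices add up without correction. *)
Lemma walk_cat D1 D2 u v u' v' l1 l2 :
  [disjoint D1 & D2] -> walk D1 u v l1 -> e v u' -> walk D2 u' v' l2 ->
  walk (D1 :|: D2) u v' (l1 + l2).
Proof.
move=> dD [p [pp up lp sp <-]] evu [q [pq uq lq sq <-]].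
exists (p ++ u' :: q); split.
- by rewrite cat_path pp /= lp evu.
- rewrite -cat_cons cat_uniq up; apply/andP; split=> //; rewrite uq andbT.
  apply/hasPn => w /sq wD2; apply/negP => /sp wD1.
  by rewrite (disjointFr dD wD1) in wD2.
- by rewrite last_cat.
- by move=> w; rewrite -cat_cons mem_cat in_setU => /orP[/sp|/sq] ->; rewrite ?orbT.
- by rewrite size_cat /=; lia.
Qed.

Lemma walk_rev D u v l : walk D u v l -> walk D v u l.
Proof.
move=> [p [pp up <- sp <-]]; exists (rev (belast u p)).
have E : last u p :: rev (belast u p) = rev (u :: p) by rewrite [u :: p]lastI rev_rcons.
split.
- by rewrite rev_path (eq_path (e' := e)) // => a b; rewrite sym_e.
- by rewrite E rev_uniq.
- case: p {pp up sp E} => //= a p; by rewrite rev_cons last_rcons.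
- by move=> w; rewrite E mem_rev; apply: sp.
- by rewrite size_rev size_belast.
Qed.

Lemma lengths_rev D X Y l : lengths D X Y l -> lengths D Y X l.
Proof. by move=> [u [v [uX vY /walk_rev uv]]]; exists v, u. Qed.

(* For C included in A, [closed_in A C] says that C is a union of components of
   A; if v is in A but not in C, [cut_in A v C] says the same of A - v. *)
Definition closed_in A C : Prop :=
  forall u w, u \in C -> w \in A -> e u w -> w \in C.
Definition cut_in A v C : Prop :=
  forall u w, u \in C -> w \in A -> e u w -> w != v -> w \in C.
Definition meets C D : Prop := exists2 c, c \in C & c \in D.
(** Phrased by closed subsets because it mostly serves to identify sets: a nonempty closed part of
    [C] is all of [C]. The empty set counts as connected. *)
Definition connected C : Prop :=
  forall F u, u \in F -> F \subset C -> closed_in C F -> C = F.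

Lemma connected_walk C u v :
  connected C -> u \in C -> v \in C -> exists l, walk C u v l.
Proof.
move=> cC uC vC; pose r := [rel a b | [&& a \in C, b \in C & e a b]].
pose F := [set w in C | connect r u w].
have FC : C = F.
  apply: (cC F u); rewrite ?inE ?uC ?connect0 //.
    by apply/subsetP=> w; rewrite inE => /andP[].
  move=> a b; rewrite !inE => /andP[aC ca] bC eab; rewrite bC /=.
  by apply: connect_trans ca _; apply: connect1; rewrite /= aC bC.
have: v \in F by rewrite -FC.
rewrite inE vC /= => /connectP[p pp ->].
case/shortenP: pp => q pq uq _; exists (size q).+1, q; split=> //.
  by apply: sub_path pq => a b /and3P[].
move=> w; rewrite inE => /orP[/eqP->//|wq].
by elim: q u {uC uq cC F FC} pq wq => //= a q IH u /andP[/and3P[_ aC _] pq];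
  rewrite inE => /orP[/eqP->//|/(IH a)]; apply.
Qed.

Lemma component D u : u \in D ->
  exists C, [/\ u \in C, C \subset D, closed_in D C & connected C].
Proof.
move=> uD; pose r := [rel a b | [&& a \in D, b \in D & e a b]].
have sr : connect_sym r.
  by apply: sym_connect_sym => a b /=; rewrite sym_e; case: (a \in D); case: (b \in D).
pose C := [set w in D | connect r u w]; exists C; split.
- by rewrite inE uD connect0.
- by apply/subsetP=> w; rewrite inE => /andP[].
- move=> a b; rewrite !inE => /andP[aC ca] bC eab; rewrite bC /=.
  by apply: connect_trans ca _; apply: connect1; rewrite /= aC bC.
move=> F w wF FC cF; apply/eqP; rewrite eqEsubset FC andbT.
apply/subsetP=> v; rewrite inE => /andP[vD uv].
have: w \in C by apply: (subsetP FC).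
rewrite inE sr => /andP[wD wu]; have := connect_trans wu uv.
case/connectP=> p; elim: p w wF {wD wu} => /= [|a p IH] w wF; first by move=> _ ->.
case/andP=> /and3P[wD aD ewa] pp lp; apply: IH pp lp.
have aC : a \in C.
  have: w \in C by apply: (subsetP FC).
  rewrite !inE aD => /andP[_ uw]; apply: connect_trans uw _.
  by apply: connect1; rewrite /= wD aD.
exact: cF ewa.
Qed.

(** The walk is cut at its last vertex in [C]. *)
Lemma exit_walk A C Y u v l : u \in C -> v \in Y -> walk A u v l ->
  exists u' v' l', [/\ u' \in C, v' \in Y & walk (u' |: (A :\: C)) u' v' l'].
Proof.
move=> uC vY [p [pp up lp sp _]].
have : has (mem C) (u :: p) by rewrite /= uC.
elim: p u {uC} pp up lp sp => [|a p IH] u pp up lp sp.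
  rewrite /= orbF => uC; exists u, u, 1; split=> //; first by rewrite /= in lp; rewrite lp.
  by apply: walk1; rewrite setU11.
case: (boolP (has (mem C) (a :: p))) => [hC _|nC].
  move: pp up => /= /andP[_ pp] /andP[_ up]; apply: (IH a) => // x xp.
  by apply: sp; rewrite inE xp orbT.
rewrite /= -[_ || has _ p]/(has (mem C) (a :: p)) (negPf nC) orbF => uC.
exists u, v, (size (a :: p)).+1; split=> //; exists (a :: p); split=> // w.
rewrite inE => /orP[/eqP->|wp]; first by rewrite setU11.
by rewrite !inE (hasPn nC w wp) sp ?orbT // inE wp orbT.
Qed.

Definition nbrs v : {set V} := [set w | e v w].
Definition Nbrs U : {set V} := \bigcup_(u in U) nbrs u.
Definition deg A v : nat := #|nbrs v :&: A|.

Lemma NbrsP U w : reflect (exists2 u, u \in U & e u w) (w \in Nbrs U).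
Proof.
by apply: (iffP bigcupP) => -[u uU h]; exists u; rewrite // inE in h *.
Qed.

Lemma deg_subU A B C v : A \subset B :|: C -> deg A v <= deg B v + deg C v.
Proof.
move=> sA; apply: leq_trans (leq_card_setU _ _); rewrite -setIUr.
exact/subset_leq_card/setIS.
Qed.

Lemma deg_sub A B v : A \subset B -> deg A v <= deg B v.
Proof. by move=> sA; apply/subset_leq_card/setIS. Qed.

Lemma deg_le_card A v : deg A v <= #|A|.
Proof. exact/subset_leq_card/subsetIr. Qed.

Lemma deg_set1 b v : deg [set b] v = e v b.
Proof.
rewrite /deg; case: (boolP (e v b)) => evb.
  rewrite (_ : _ :&: _ = [set b]) ?cards1 //; apply/setP=> w; rewrite !inE.
  by case: eqVneq => [->|]; rewrite ?evb ?andbF.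
rewrite (_ : _ :&: _ = set0) ?cards0 //; apply/setP=> w; rewrite !inE.
by case: eqVneq => [->|]; rewrite ?(negPf evb) ?andbF.
Qed.

Lemma deg_eq0 A v : v \notin Nbrs A -> deg A v = 0.
Proof.
move=> vN; apply/eqP; rewrite cards_eq0; apply/eqP/setP=> w; rewrite !inE.
apply: contraNF vN => /andP[evw wA]; apply/NbrsP; exists w => //.
by rewrite sym_e.
Qed.

Lemma deg_gt1 A v : 1 < deg A v ->
  exists t1 t2, [/\ t1 != t2, t1 \in A, t2 \in A, e v t1 & e v t2].
Proof.
move/card_gt1P => [t1 [t2 [/setIP[h1 a1] /setIP[h2 a2] n]]].
by exists t1, t2; rewrite !inE in h1 h2 *.
Qed.

Lemma deg_gt0 A v : 0 < deg A v -> exists2 t, t \in A & e v t.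
Proof. by move/card_gt0P => [t /setIP[]]; rewrite inE => ? ?; exists t. Qed.

(* A stands for V(G) - {x, y}, with X and Y the neighbourhoods of the roots x
   and y in A, so that deleting or contracting part of the graph only changes
   these three sets. The two conditions say that G + xy is 2-connected. *)
Record rooted A X Y : Prop := Rooted {
  rooted_subl : X \subset A;
  rooted_subr : Y \subset A;
  rooted_closed : forall C c, c \in C -> C \subset A -> closed_in A C ->
    meets C X /\ meets C Y;
  rooted_cut : forall C c v, c \in C -> C \subset A -> v \in A -> v \notin C ->
    cut_in A v C -> meets C (X :|: Y)
}.

(** The degree in the graph with its roots: the two memberships stand for the edges to x and y.
    Contracting a set into a root turns all edges to that set into one such unit. *)
Definition rdeg A X Y v : nat := deg A v + (v \in X) + (v \in Y).
Definition good k A X Y : Prop := admissible k (lengths A X Y).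

(** * Passing to parts of a rooted pair *)

Lemma rooted_sym A X Y : rooted A X Y -> rooted A Y X.
Proof.
case=> sX sY hc hv; split=> // [C c cC CA /(hc C c cC CA)[]//|C c v].
by rewrite setUC; apply: hv.
Qed.

Lemma good_sym k A X Y : good k A X Y -> good k A Y X.
Proof.
by apply: (admissible_impl (r := 0)) => l /lengths_rev; rewrite addn0.
Qed.

Lemma rooted_connected B X Y x y : connected B -> X \subset B -> Y \subset B ->
  x \in X -> y \in Y ->
  (forall F c v, c \in F -> F \subset B -> v \in B -> v \notin F -> cut_in B v F ->
     meets F (X :|: Y)) ->
  rooted B X Y.
Proof.
move=> cB sX sY xX yY hv; split=> // C c cC CB clC.
have <- := cB C c cC CB clC.
by split; [exists x => //; apply: (subsetP sX) | exists y => //; apply: (subsetP sY)].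
Qed.

Lemma lengths_cat D1 D2 X Y W l1 l2 : [disjoint D1 & D2] ->
  (forall w, w \in W -> exists u, e w u /\ lengths D1 X [set u] l1) ->
  lengths D2 W Y l2 -> lengths (D1 :|: D2) X Y (l1 + l2).
Proof.
move=> dD h1 [w [v [wW vY W2]]].
have [u [ewu [x [_ [xX /set1P-> W1]]]]] := h1 w wW.
by exists x, v; split=> //; apply: walk_cat W1 _ W2; rewrite 1?sym_e.
Qed.

Lemma lengths_cat_set D1 D2 X Y U l1 l2 : [disjoint D1 & D2] ->
  (forall u, u \in U -> lengths D1 X [set u] l1) ->
  lengths D2 (Nbrs U :&: D2) Y l2 -> lengths (D1 :|: D2) X Y (l1 + l2).
Proof.
move=> dD h1; apply: lengths_cat => // w /setIP[/NbrsP[u uU euw] _].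
by exists u; rewrite sym_e euw; split=> //; apply: h1.
Qed.

Lemma lengths_cat_vertex D1 D2 X Y b l1 l2 : [disjoint D1 & D2] ->
  lengths D1 X (nbrs b :&: D1) l1 -> lengths D2 [set b] Y l2 ->
  lengths (D1 :|: D2) X Y (l1 + l2).
Proof.
move=> dD [u [v [uX /setIP[vb _] W1]]] [_ [y [/set1P-> yY W2]]].
exists u, y; split=> //; apply: walk_cat W1 _ W2 => //.
by rewrite inE sym_e in vb.
Qed.

(** Edges of [A] that leave [F] can only end in [H]. So either the conditions on [A] govern [F], or
    [F] is seen by the root into which [H] is contracted. *)
Lemma closed_or_adj A H E F : closed_in (A :\: H) E -> F \subset E ->
  closed_in E F -> closed_in A F \/ exists u w, [/\ u \in F, w \in A :&: H & e u w].
Proof.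
move=> cE /subsetP FE cF; case: (classic (exists u w, [/\ u \in F, w \in A :&: H & e u w])).
  by right.
move=> N; left=> u w uF wA euw; case: (boolP (w \in H)) => wH.
  by case: N; exists u, w; rewrite inE wA wH.
by apply: (cF u) => //; apply: (cE u); rewrite ?inE ?wA ?wH //; apply: FE.
Qed.

Lemma cut_or_adj A H E F v : closed_in (A :\: H) E -> F \subset E ->
  cut_in E v F -> cut_in A v F \/ exists u w, [/\ u \in F, w \in A :&: H & e u w].
Proof.
move=> cE /subsetP FE cF; case: (classic (exists u w, [/\ u \in F, w \in A :&: H & e u w])).
  by right.
move=> N; left=> u w uF wA euw wv; case: (boolP (w \in H)) => wH.
  by case: N; exists u, w; rewrite inE wA wH.
by apply: (cF u) => //; apply: (cE u); rewrite ?inE ?wA ?wH //; apply: FE.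
Qed.

(** Otherwise the component of [v] in [A :\: C], united with [C], would be closed in [A] and miss
    [Y]. *)
Lemma cut_exit A X Y C v : rooted A X Y -> C \subset A -> v \in A -> v \notin C ->
  cut_in A v C -> ~ meets C Y -> exists l, lengths (A :\: C) [set v] Y l.
Proof.
move=> rA CA vA vC ctC nCY.
have vAC : v \in A :\: C by rewrite inE vC.
have [F [vF FAC clF cF]] := component vAC.
have [||u w|_ [y]] := @rooted_closed _ _ _ rA (F :|: C) v.
- by rewrite inE vF.
- by rewrite subUset CA (subset_trans FAC) // subsetDl.
- rewrite !inE => uFC wA euw; case: (boolP (w \in C)) => wC; first by rewrite orbT.
  rewrite orbF; case/orP: uFC => [uF|uC].
    by apply: (clF u) => //; rewrite inE wC.
  by have [->//|/(ctC u w uC wA euw)] := eqVneq w v; rewrite (negPf wC).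
rewrite inE => /orP[yF|yC] yY; last by case: nCY; exists y.
have [l W] := connected_walk cF vF yF.
by exists l, v, y; rewrite inE eqxx; split=> //; apply: walk_sub W.
Qed.

(** The vertex [v] takes over the role of y, because [C] is attached to the rest only through x and
    [v]. *)
Lemma rooted_cut_part A X Y C c v : rooted A X Y -> c \in C -> C \subset A ->
  v \in A -> v \notin C -> cut_in A v C -> ~ meets C Y ->
  rooted C (X :&: C) (nbrs v :&: C).
Proof.
move=> rA cC CA vA vC ctC nCY.
have cutF F w : F \subset C -> cut_in C w F -> cut_in A w F \/ meets F (nbrs v).
  move=> /subsetP FC ctF; case: (classic (meets F (nbrs v))); first by right.
  move=> N; left=> u x uF xA eux xw; apply: (ctF u) => //.
  apply: (ctC u) => //; first exact: FC.
  by apply/eqP=> E; case: N; exists u; rewrite // inE sym_e -E.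
have meetX F w d : d \in F -> F \subset C -> w \in A -> w \notin F -> cut_in A w F -> meets F (X :&: C).
  move=> dF FC wA wF ctF; have [x xF] := rooted_cut rA dF (subset_trans FC CA) wA wF ctF.
  rewrite inE => /orP[xX|xY]; first by exists x; rewrite // inE xX (subsetP FC).
  by case: nCY; exists x; rewrite // (subsetP FC).
split; try exact: subsetIr.
  move=> F d dF FC clF; split.
    apply: (meetX F v d) => //; first by apply: contra vC => /(subsetP FC).
    move=> u x uF xA eux xv; apply: (clF u) => //; apply: (ctC u) => //.
    exact: (subsetP FC).
  case: (classic (meets F (nbrs v))) => [[x xF xv]|N].
    by exists x; rewrite // inE xv (subsetP FC).
  have [||u x uF xA eux|_ [x xF xY]] := @rooted_closed _ _ _ rA F d => //.
  - exact: subset_trans CA.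
  - apply: (clF u) => //; apply: (ctC u) => //; first exact: (subsetP FC).
    by apply/eqP=> E; case: N; exists u; rewrite // inE sym_e -E.
  by case: nCY; exists x; rewrite // (subsetP FC).
move=> F d w dF FC wC wF ctF; have [ctA|[x xF xv]] := cutF F w FC ctF.
  have [x xF xX] := meetX F w d dF FC (subsetP CA _ wC) wF ctA.
  by exists x; rewrite // inE xX.
by exists x; rewrite // in_setU !in_setI xv (subsetP FC x xF) orbT.
Qed.

(** One fixed walk from [v] to [Y] outside [C] prolongs all walks in [C], so every length shifts by
    the same [r]. *)
Lemma good_cut_part k A X Y C v : rooted A X Y -> C \subset A -> v \in A ->
  v \notin C -> cut_in A v C -> ~ meets C Y ->
  good k C (X :&: C) (nbrs v :&: C) -> good k A X Y.
Proof.
move=> rA CA vA vC ctC nCY.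
have [r Hr] := cut_exit rA CA vA vC ctC nCY.
apply: (admissible_impl (r := r)) => l Hl.
have dC : [disjoint C & A :\: C] by rewrite -setI_eq0 setIDA setIC -setIDA setDv setI0.
have := lengths_cat_vertex dC Hl Hr; apply: lengths_sub => //; last exact: subsetIl.
by rewrite subUset CA subsetDl.
Qed.

(** The edge to [v] is traded for membership in the new root set, and [C] has no edges to y. *)
Lemma rdeg_cut_part A Y C v w X : C \subset A -> v \in A -> v \notin C ->
  cut_in A v C -> ~ meets C Y -> w \in C ->
  rdeg A X Y w <= rdeg C (X :&: C) (nbrs v :&: C) w.
Proof.
move=> CA vA vC ctC nCY wC; rewrite /rdeg !in_setI wC !andbT.
have -> : (w \in Y) = false by apply/negP=> wY; case: nCY; exists w.
have := @deg_set1 v w; have : deg A w <= deg C w + deg [set v] w.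
  rewrite -/(deg (C :|: [set v]) w).
  apply: leq_trans (deg_subU (A := C :|: [set v]) _ (subxx _)).
  apply/subset_leq_card/subsetP=> x; rewrite !inE => /andP[ewx xA].
  rewrite ewx; have [->|xv] := eqVneq x v; first by rewrite orbT.
  by rewrite (ctC w).
by rewrite inE sym_e; nlia.
Qed.

Lemma rooted_walk A X Y u : rooted A X Y -> u \in A ->
  exists y l, y \in Y /\ walk A u y l.
Proof.
move=> rA uA; have [C [uC CA clC cC]] := component uA.
have [_ [y yC yY]] := rooted_closed rA uC CA clC.
have [l W] := connected_walk cC uC yC; exists y, l; split=> //.
exact: walk_sub W.
Qed.

(** [H] is contracted into the root x. A part cut off in [E] touches [H], or else it is cut off in
    [A] too and therefore meets [Y]. *)
Lemma rooted_component A Y H E y0 : E \subset A :\: H ->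
  closed_in (A :\: H) E -> connected E -> y0 \in E -> y0 \in Y ->
  ~ closed_in A E ->
  (forall F c v, c \in F -> F \subset E -> v \in A -> v \notin F -> cut_in A v F ->
     meets F Y) ->
  rooted E (Nbrs H :&: E) (Y :&: E).
Proof.
move=> EA clE cE yE yY nclE ctY.
have [//|[x [h [xE /setIP[_ hH] exh]]]] := closed_or_adj clE (subxx E) (fun _ _ _ wE _ => wE).
apply: (@rooted_connected _ _ _ x y0) => //; try exact: subsetIr.
- by rewrite inE xE andbT; apply/NbrsP; exists h; rewrite // sym_e.
- by rewrite inE yE yY.
move=> F c v cF FE vE vF ctF.
have [ctA|[f [w [fF /setIP[_ wH] efw]]]] := cut_or_adj clE FE ctF.
  have vA : v \in A by have := subsetP EA _ vE; rewrite inE => /andP[].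
  have [f fF fY] := ctY F c v cF FE vA vF ctA.
  by exists f; rewrite // !inE fY (subsetP FE f fF) orbT.
exists f; rewrite // in_setU !in_setI (subsetP FE f fF) !andbT.
by apply/orP; left; apply/NbrsP; exists w; rewrite // sym_e.
Qed.

(** Meant for components that see neither x nor y: [t] becomes one root, and the rest of [H],
    contracted, the other. *)
Lemma rooted_component_split A H E t c : E \subset A :\: H ->
  closed_in (A :\: H) E -> connected E -> t \in H -> t \in A -> c \in E -> e c t ->
  (forall F c v, c \in F -> F \subset E -> v \in A -> v \notin F -> cut_in A v F ->
     False) ->
  rooted E (Nbrs (H :\ t) :&: E) (nbrs t :&: E).
Proof.
move=> EA clE cE tH tA cE' ect ct0.
have tE : t \notin E by apply/negP=> /(subsetP EA); rewrite inE tH.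
have [x xE xH] : meets E (Nbrs (H :\ t)).
  case: (classic (meets E (Nbrs (H :\ t)))) => // N; case: (ct0 E c t) => //.
  move=> u w uE wA euw wt; case: (boolP (w \in H)) => wH.
    by case: N; exists u; rewrite //; apply/NbrsP; exists w; rewrite ?inE ?wt // sym_e.
  by apply: (clE u); rewrite // inE wH.
apply: (@rooted_connected _ _ _ x c) => //; try exact: subsetIr.
- by rewrite inE xH.
- by rewrite !inE cE' sym_e ect.
move=> F f v fF FE vE vF ctF.
have [ctA|[u [w [uF /setIP[_ wH] euw]]]] := cut_or_adj clE FE ctF.
  by case: (ct0 F f v) => //; have := subsetP EA _ vE; rewrite inE => /andP[].
exists u; rewrite // in_setU !in_setI (subsetP FE u uF) !andbT.
have [E1|wt] := eqVneq w t; first by rewrite -E1 !inE (sym_e w) euw orbT.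
by apply/orP; left; apply/NbrsP; exists w; rewrite ?inE ?wt // sym_e.
Qed.

Lemma admissible2 (P : nat -> Prop) l d : d = 1 \/ d = 2 -> P l -> P (l + d) ->
  admissible 2 P.
Proof.
move=> hd P0 P1; exists l, d; split=> // -[|[|//]] _; first by rewrite muln0 addn0.
by rewrite muln1.
Qed.

(** * Two paths, one exceptional vertex *)

(** A walk to [Y] starts at its last vertex among [x1] and [x2]; putting the other one in front
    makes it longer by 1. *)
Lemma good2_edge A X Y x1 x2 : rooted A X Y -> x1 \in X -> x2 \in X -> e x1 x2 ->
  good 2 A X Y.
Proof.
move=> rA x1X x2X ex; have sX := subsetP (rooted_subl rA).
have [y [l [yY W]]] := rooted_walk rA (sX _ x1X).
have [u [y' [l' [uC yY' W']]]] := exit_walk (set21 x1 x2) yY W.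
have uX : u \in X by case/set2P: uC => ->.
have uA := sX u uX.
have [v [vX vC vu evu]] : exists v, [/\ v \in X, v \in [set x1; x2], v != u & e v u].
  case/set2P: uC => ->; [exists x2 | exists x1]; split=> //; rewrite ?set21 ?set22 // 1?sym_e //.
    by apply: contraTneq ex => ->; rewrite irr_e.
  by apply: contraTneq ex => ->; rewrite irr_e.
have sub : u |: A :\: [set x1; x2] \subset A by rewrite subUset sub1set uA subsetDl.
apply: (@admissible2 _ l' 1); first by left.
  by exists u, y'; split=> //; apply: walk_sub W'.
exists v, y'; split=> //; rewrite addnC.
have d1 : [disjoint [set v] & u |: A :\: [set x1; x2]].
  by rewrite disjoints1 in_setU1 in_setD vC (negPf vu).
apply: walk_sub (walk_cat d1 (walk1 (set11 v)) evu W').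
by rewrite subUset sub1set sX.
Qed.

(** If [t1] or [t2] reaches [Y] without [a], a walk from the last of them can start there directly,
    or with the other one and [a] in front, a difference of 2. Otherwise [a] cuts off a part from
    [Y], and induction applies to that part. *)
Lemma good2_c4 n A X Y z a t1 t2 :
  (forall A X Y z, #|A| < n -> rooted A X Y ->
     (forall v, v \in A -> v != z -> 2 < rdeg A X Y v) ->
     (exists2 v, v \in A & v != z) -> good 2 A X Y) ->
  #|A| <= n -> rooted A X Y ->
  (forall v, v \in A -> v != z -> 2 < rdeg A X Y v) ->
  a \in A -> a \notin X -> t1 \in X -> t2 \in X -> t1 != t2 -> e a t1 -> e a t2 ->
  good 2 A X Y.
Proof.
move=> IH An rA dA aA aX t1X t2X t12 ea1 ea2; have sX := subsetP (rooted_subl rA).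
have inA t : t \in X -> t \in A :\ a.
  by move=> tX; rewrite !inE sX // andbT; apply: contraNneq aX => <-.
case: (classic (exists t y l, [/\ t \in [set t1; t2], y \in Y & walk (A :\ a) t y l])).
  move=> [t [y [l [tT yY W]]]].
  have [u [y' [l' [uC yY' W']]]] := exit_walk tT yY W.
  have [v [vX vC vu eav]] : exists v, [/\ v \in X, v \in [set t1; t2], v != u & e a v].
    case/set2P: uC => ->; [exists t2 | exists t1]; split=> //; rewrite ?set21 ?set22 //.
    by rewrite eq_sym.
  have [uX eau] : u \in X /\ e a u by case/set2P: uC => ->.
  have va : v != a by apply: contraNneq aX => <-.
  have sub : u |: (A :\ a) :\: [set t1; t2] \subset A :\ a.
    by rewrite subUset sub1set inA // subsetDl.
  have d1 : [disjoint [set a] & u |: (A :\ a) :\: [set t1; t2]].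
    by rewrite disjoints1; apply/negP=> /(subsetP sub); rewrite !inE eqxx.
  have W2 := walk_cat d1 (walk1 (set11 a)) eau W'.
  have d2 : [disjoint [set v] & [set a] :|: (u |: (A :\ a) :\: [set t1; t2])].
    by rewrite disjoints1 in_setU in_setU1 in_setD vC in_set1 (negPf va) (negPf vu).
  have eva : e v a by rewrite sym_e.
  have W3 := walk_cat d2 (walk1 (set11 v)) eva W2.
  apply: (@admissible2 _ l' 2); first by right.
    exists u, y'; split=> //; apply: walk_sub W'; apply: subset_trans sub _.
    exact: subsetDl.
  exists v, y'; split=> //; rewrite addnC -[2]/(1 + 1) -addnA; apply: walk_sub W3.
  rewrite !subUset !sub1set sX // aA /=.
  by rewrite sX //=; apply: subset_trans (subsetDl _ _) (subsetDl _ _).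
(* The induction needs a vertex other than [z] in the smaller part. *)
move=> N; have [t tT tz] : exists2 t, t \in [set t1; t2] & t != z.
  have [E|] := eqVneq t1 z; last by exists t1; rewrite ?set21.
  by exists t2; rewrite ?set22 // -E eq_sym.
have tX : t \in X by case/set2P: tT => ->.
have [C [tC CA clC cC]] := component (inA t tX).
have nCY : ~ meets C Y.
  move=> [y yC yY]; have [l W] := connected_walk cC tC yC.
  by case: N; exists t, y, l; split=> //; apply: walk_sub W.
have ct : cut_in A a C.
  by move=> u w uC wA euw wa; apply: (clC u); rewrite // !inE wa.
have aC : a \notin C by apply/negP=> /(subsetP CA); rewrite !inE eqxx.
have CA' : C \subset A := subset_trans CA (subsetDl _ _).
apply: (good_cut_part rA CA' aA aC ct nCY); apply: (IH _ _ _ z).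
- apply: leq_trans An; apply: proper_card; rewrite properE CA'.
  by apply/subsetPn; exists a.
- exact: rooted_cut_part rA tC CA' aA aC ct nCY.
- move=> v vC vz; apply: leq_trans (rdeg_cut_part X CA' aA aC ct nCY vC).
  by apply: dA => //; apply: (subsetP CA').
by exists t.
Qed.

Lemma deg_cover A B C v : (forall w, w \in A -> e v w -> (w \in B) || (w \in C)) ->
  deg A v <= deg B v + deg C v.
Proof.
move=> h; apply: leq_trans (leq_card_setU _ _); rewrite -setIUr.
apply/subset_leq_card/subsetP=> w; rewrite !inE => /andP[evw wA].
by rewrite evw h.
Qed.

Lemma deg_component A H E v : closed_in (A :\: H) E -> v \in E ->
  deg A v <= deg E v + deg H v.
Proof.
move=> clE vE; apply: deg_cover => w wA evw; case: (boolP (w \in H)) => wH.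
  by rewrite orbT.
by rewrite orbF; apply: (clE v); rewrite // inE wH.
Qed.

(** Shaped for case analysis: splitting on [v \in Nbrs U] leaves either a tautology or the fact that
    the degree is 0. *)
Lemma deg_Nbrs U v : deg U v <= deg U v * (v \in Nbrs U).
Proof. by case: (boolP (v \in Nbrs U)) => [|/deg_eq0->]; rewrite ?muln1. Qed.

Lemma lengths_self X U u : u \in U -> U \subset X -> lengths U X [set u] 1.
Proof.
move=> uU /subsetP UX; exists u, u; split; [exact: UX | exact: set11 |].
exact: walk1.
Qed.

Lemma rooted_nonempty A X Y a : rooted A X Y -> a \in A -> meets A X /\ meets A Y.
Proof. by move=> rA aA; apply: (rooted_closed rA aA (subxx A)). Qed.

(** Contracting [X] into the root costs no degree, since a vertex outside has at most one neighbour
    in [X] and keeps it as a root edge. *)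
Lemma good2_star n A X Y z y0 :
  (forall A X Y z, #|A| < n -> rooted A X Y ->
     (forall v, v \in A -> v != z -> 2 < rdeg A X Y v) ->
     (exists2 v, v \in A & v != z) -> good 2 A X Y) ->
  #|A| <= n -> rooted A X Y ->
  (forall v, v \in A -> v != z -> 2 < rdeg A X Y v) ->
  (forall a, a \in A -> a \notin X -> deg X a <= 1) ->
  y0 \in Y -> y0 \notin X -> y0 != z -> good 2 A X Y.
Proof.
move=> IH An rA dA star yY yX yz; have sX := subsetP (rooted_subl rA).
have yA : y0 \in A := subsetP (rooted_subr rA) _ yY.
have yAX : y0 \in A :\: X by rewrite inE yX.
have [E [yE EA clE cE]] := component yAX.
have EA' : E \subset A := subset_trans EA (subsetDl _ _).
have nEX w : w \in E -> w \notin X by move/(subsetP EA); rewrite inE => /andP[].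
have HE : good 2 E (Nbrs X :&: E) (Y :&: E).
  apply: (IH _ _ _ z).
  - have [[x xA xX] _] := rooted_nonempty rA yA.
    apply: leq_trans An; apply: proper_card; rewrite properE EA'.
    by apply/subsetPn; exists x; rewrite //; apply: contraL xX; apply: nEX.
  - apply: (rooted_component EA clE cE yE yY) => [clA|F c v cF FE vA vF ctF].
      have [[x /nEX xX]] := rooted_closed rA yE EA' clA; by rewrite (negPf xX).
    have [x xF] := rooted_cut rA cF (subset_trans FE EA') vA vF ctF.
    by rewrite inE (negPf (nEX _ (subsetP FE _ xF))) => xY; exists x.
  - move=> v vE vz; have := dA v (subsetP EA' v vE) vz.
    have := deg_component clE vE; have := deg_Nbrs X v.
    have := star v (subsetP EA' v vE) (nEX v vE).
    rewrite /rdeg !in_setI vE !andbT (negPf (nEX v vE)).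
    by case: (v \in Nbrs X); nlia.
  - by exists y0.
apply: admissible_impl HE => l Hl; rewrite addnC.
have dX : [disjoint X & E].
  by rewrite disjoint_sym disjoint_subset; apply/subsetP=> w /nEX.
have := lengths_cat_set dX (fun u uX => lengths_self uX (subxx X)) Hl.
by apply: lengths_sub; rewrite ?subsetIl // subUset EA' (rooted_subl rA).
Qed.

(** No vertex outside [X] sees a root here. Some [t] in [Y] is split off as the far end and the rest
    of [X] is contracted; as no outside vertex has two neighbours in [X], no degree is lost. *)
Lemma good2_twin n A X Y z a :
  (forall A X Y z, #|A| < n -> rooted A X Y ->
     (forall v, v \in A -> v != z -> 2 < rdeg A X Y v) ->
     (exists2 v, v \in A & v != z) -> good 2 A X Y) ->
  #|A| <= n -> rooted A X Y ->
  (forall v, v \in A -> v != z -> 2 < rdeg A X Y v) ->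
  (forall a, a \in A -> a \notin X -> deg X a <= 1) ->
  {in X &, forall x1 x2, ~~ e x1 x2} ->
  Y \subset X -> (forall x, x \in X -> x \notin Y -> x = z) ->
  a \in A -> a != z -> good 2 A X Y.
Proof.
move=> IH An rA dA star indX YX XY aA az; have sX := subsetP (rooted_subl rA).
have [t tY tz] : exists2 t, t \in Y & t != z.
  have [_ [y yA yY]] := rooted_nonempty rA aA.
  have [yz|] := eqVneq y z; last by exists y.
  (* If [Y] had no vertex but [z], neither would [X], and [z] would separate everything else from
     both roots. *)
  case: (classic (exists2 t, t \in Y & t != z)) => // N.
  have [|||||x] := @rooted_cut _ _ _ rA (A :\ z) a z.
  - by rewrite !inE az.
  - exact: subsetDl.
  - by rewrite -yz.
  - by rewrite !inE eqxx.
  - by move=> u w _ wA _ wz; rewrite !inE wz.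
  rewrite !inE => /andP[xz xA] /orP[xX|xY]; last by exists x.
  case: (boolP (x \in Y)) => [xY|xY]; first by exists x.
  by rewrite (XY x) ?eqxx in xz.
have tX : t \in X := subsetP YX t tY.
have [w wA etw] : exists2 w, w \in A & e t w.
  apply: deg_gt0; have := dA t (sX t tX) tz.
  by rewrite /rdeg tX tY; nlia.
have wX : w \notin X by apply/negP=> wX; have := indX t w tX wX; rewrite etw.
have wAX : w \in A :\: X by rewrite inE wX.
have [E [wE EA clE cE]] := component wAX.
have EA' : E \subset A := subset_trans EA (subsetDl _ _).
have nEX x : x \in E -> x \notin X by move/(subsetP EA); rewrite inE => /andP[].
have ewt : e w t by rewrite sym_e.
have rE : rooted E (Nbrs (X :\ t) :&: E) (nbrs t :&: E).
  apply: (rooted_component_split EA clE cE tX (sX t tX) wE ewt).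
  move=> F c v cF FE vA vF ctF.
  have [x xF] := rooted_cut rA cF (subset_trans FE EA') vA vF ctF.
  have xX := nEX _ (subsetP FE _ xF).
  by rewrite inE (negPf xX) /= => /(subsetP YX); rewrite (negPf xX).
have degX v : v \in E -> deg X v <= (v \in Nbrs (X :\ t)) + (v \in nbrs t).
  move=> vE; have := star v (subsetP EA' v vE) (nEX v vE).
  have := deg_subU (A := X) (B := X :\ t) (C := [set t]) v.
  rewrite setUC setD1K // => /(_ (subxx _)).
  rewrite deg_set1 inE (sym_e t).
  by case: (boolP (v \in Nbrs (X :\ t))) => [_|/deg_eq0->]; nlia.
have HE : good 2 E (Nbrs (X :\ t) :&: E) (nbrs t :&: E).
  apply: (IH _ _ _ z) => //.
  - apply: leq_trans An; apply: proper_card; rewrite properE EA'.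
    by apply/subsetPn; exists t; rewrite ?sX //; apply: contraL tX; apply: nEX.
  - move=> v vE vz; have := dA v (subsetP EA' v vE) vz.
    have := deg_component clE vE; have := degX v vE.
    have nvY : v \notin Y by apply: contra (nEX v vE); apply: (subsetP YX).
    rewrite /rdeg !in_setI vE !andbT (negPf (nEX v vE)) (negPf nvY); nlia.
  (* If [z] were all of [E], both new roots would attach to it, giving it two neighbours in [X]. *)
  - have [wz|] := eqVneq w z; last by exists w.
    case: (classic (exists2 v, v \in E & v != z)) => // N.
    have [[v vE /setIP[/NbrsP[s /setD1P[st sX'] esv] _]] _] := rooted_nonempty rE wE.
    have vw : v = w.
      by rewrite wz; apply/eqP; apply: contraT => vz; case: N; exists v.
    have: 1 < deg X w.
      apply/card_gt1P; exists s, t; rewrite !inE ewt sX' tX sym_e -vw esv; split=> //.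
    by rewrite ltnNge star.
have dXE : [disjoint X & E].
  by rewrite disjoint_sym disjoint_subset; apply/subsetP=> x /nEX.
apply: (admissible_impl (r := 2)) HE => l Hl; rewrite addnC.
have dE1 : [disjoint X :\ t & E] by apply: disjointWl dXE; apply: subsetDl.
have H1 := lengths_cat_set dE1 (fun u uX => lengths_self uX (subxx (X :\ t))) Hl.
have H2 : lengths [set t] [set t] Y 1.
  by exists t, t; split; rewrite ?set11 //; apply/walk1/set11.
have dE2 : [disjoint (X :\ t) :|: E & [set t]].
  by rewrite disjoint_sym disjoints1 !inE eqxx /=; apply: contraL tX; apply: nEX.
have sH1 : nbrs t :&: E \subset nbrs t :&: ((X :\ t) :|: E) by apply/setIS/subsetUr.
have := lengths_cat_vertex dE2 (lengths_sub (subxx _) (subxx _) sH1 H1) H2.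
rewrite addnAC; apply: lengths_sub => //; last exact: subsetDl.
by rewrite !subUset EA' sub1set sX // (subset_trans (subsetDl _ _) (rooted_subl rA)).
Qed.

(** Once the previous cases are excluded for both orders of the roots, only [z] can lie in exactly
    one of [X] and [Y]. Hence one contains the other, and [good2_twin] applies. *)
Lemma good2_exceptional n A X Y z : #|A| <= n -> rooted A X Y ->
  (forall v, v \in A -> v != z -> 2 < rdeg A X Y v) ->
  (exists2 v, v \in A & v != z) -> good 2 A X Y.
Proof.
elim: n A X Y z => [|n IH0] A X Y z An rA dA [a aA az].
  by move: An; rewrite leqn0 cards_eq0 => /eqP A0; rewrite A0 inE in aA.
have IH A' X' Y' z' : #|A'| < n.+1 -> rooted A' X' Y' ->
     (forall v, v \in A' -> v != z' -> 2 < rdeg A' X' Y' v) ->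
     (exists2 v, v \in A' & v != z') -> good 2 A' X' Y' by apply: IH0.
have half X' Y' : rooted A X' Y' ->
    (forall v, v \in A -> v != z -> 2 < rdeg A X' Y' v) ->
    good 2 A X' Y' \/ [/\ forall a, a \in A -> a \notin X' -> deg X' a <= 1,
      {in X' &, forall x1 x2, ~~ e x1 x2} & forall y, y \in Y' -> y \notin X' -> y = z].
  move=> rA' dA'; case: (classic (good 2 A X' Y')) => [|N]; [by left | right].
  have star b : b \in A -> b \notin X' -> deg X' b <= 1.
    move=> bA bX; rewrite leqNgt; apply/negP=> /deg_gt1[t1 [t2 [t12 t1X t2X e1 e2]]].
    by apply: N; apply: (good2_c4 IH An rA' dA' bA bX t1X t2X).
  split=> // [x1 x2 x1X x2X|y yY yX].
    by apply/negP=> e12; apply: N; apply: good2_edge rA' x1X x2X e12.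
  by apply/eqP; apply: contraT => yz; case: N; apply: (good2_star IH An rA' dA' star yY yX yz).
have [//|[starX indX hX]] := half X Y rA dA.
have dA' v : v \in A -> v != z -> 2 < rdeg A Y X v.
  by rewrite /rdeg addnAC; apply: dA.
have [/good_sym//|[starY indY hY]] := half Y X (rooted_sym rA) dA'.
case: (boolP (Y \subset X)) => [YX|/subsetPn[y yY yX]].
  exact: good2_twin IH An rA dA starX indX YX hY aA az.
case: (boolP (X \subset Y)) => [XY|/subsetPn[x xX xY]].
  exact/good_sym/(good2_twin IH An (rooted_sym rA) dA' starY indY XY hX aA az).
by move: (xY); rewrite (hY x xX xY) -(hX y yY yX) yY.
Qed.

Lemma deg_Nbrs_gt0 U v : v \in Nbrs U -> 0 < deg U v.
Proof.
by move/NbrsP=> [u uU euv]; apply/card_gt0P; exists u; rewrite !inE sym_e euv.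
Qed.

Lemma Nbrs_deg U v : (v \in Nbrs U) <= deg U v.
Proof. by case: (boolP (v \in Nbrs U)) => // /deg_Nbrs_gt0. Qed.

(** * Complete bipartite cores *)

(** Alternating walks with [i] vertices in [S]. They start in [T] because [T] will consist of
    neighbours of x. *)
Lemma zigzag i S T t : [disjoint S & T] -> {in S & T, forall a t, e a t} ->
  t \in T -> i <= #|S| -> i < #|T| -> lengths (S :|: T) T [set t] (1 + 2 * i).
Proof.
elim: i S T t => [|i IH] S T t dST eST tT iS iT.
  apply: lengths_sub (lengths_self tT (subxx T)) => //; exact: subsetUr.
have [a aS] : exists a, a \in S by apply/card_gt0P; apply: leq_trans iS.
have [t' t'T] : exists t', t' \in T :\ t.
  by apply/card_gt0P; move: iT; rewrite (cardsD1 t T) tT; nlia.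
have [||||u [_ [uT /set1P-> W]]] := IH (S :\ a) (T :\ t) t' _ _ t'T.
- by apply: disjointWl (subsetDl _ _) _; apply: disjointWr dST; apply: subsetDl.
- by move=> b s /setD1P[_ bS] /setD1P[_ sT]; apply: eST.
- by move: iS; rewrite (cardsD1 a S) aS; nlia.
- by move: iT; rewrite (cardsD1 t T) tT; nlia.
have [_ t'T'] := setD1P t'T; have [_ uT'] := setD1P uT.
have eta : e t' a by rewrite sym_e eST.
have aT : a \notin T by rewrite (disjointFr dST aS).
have tS : t \notin S by rewrite (disjointFl dST tT).
have Wat : walk [set a; t] a t 2.
  by apply: (walk_cat _ (walk1 (set11 a)) (eST a t aS tT) (walk1 (set11 t)));
     rewrite disjoints1 inE; apply: contraNneq aT => ->.
have dD : [disjoint (S :\ a) :|: (T :\ t) & [set a; t]].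
  rewrite disjoint_sym; apply/pred0P=> x /=; apply/negbTE; rewrite !inE.
  apply/negP=> /andP[/orP[]/eqP->]; rewrite !eqxx ?(negPf aT) ?(negPf tS) ?andbF //.
exists u, t; split; rewrite ?set11 //.
rewrite (_ : 1 + 2 * i.+1 = 1 + 2 * i + 2); last by nlia.
apply: walk_sub (walk_cat dD W eta Wat).
rewrite !subUset !sub1set !inE aS tT orbT /= andbT.
by apply/andP; split; apply: subset_trans (subsetDl _ _) _; rewrite ?subsetUl ?subsetUr.
Qed.

Lemma zigzag_odd i S T a : [disjoint S & T] -> {in S & T, forall a t, e a t} ->
  a \in S -> i < #|S| -> i < #|T| -> lengths (S :|: T) T [set a] (2 + 2 * i).
Proof.
move=> dST eST aS iS iT.
have [t tT] : exists t, t \in T by apply/card_gt0P; apply: leq_trans iT.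
have [|||u [_ [uT /set1P-> W]]] := @zigzag i (S :\ a) T t _ _ tT _ iT.
- by apply: disjointWl dST; apply: subsetDl.
- by move=> b s /setD1P[_ bS]; apply: eST.
- by move: iS; rewrite (cardsD1 a S) aS; nlia.
have aT : a \notin T by rewrite (disjointFr dST aS).
have dD : [disjoint (S :\ a) :|: T & [set a]].
  by rewrite disjoint_sym disjoints1 !inE eqxx.
exists u, a; split; rewrite ?set11 //.
rewrite (_ : 2 + 2 * i = 1 + 2 * i + 1); last by nlia.
have eta : e t a by rewrite sym_e eST.
apply: walk_sub (walk_cat dD W eta (walk1 (set11 a))).
rewrite !subUset sub1set inE aS subsetUr !andbT /=.
by apply: subset_trans (subsetDl _ _) _; rewrite subsetUl.
Qed.

(** A new vertex with neighbourhood [Z] leaves no cut vertex in [B]. As every part cut off meets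
    [Z], any nonempty subset of [B] may serve for the other root. *)
Record block B Z : Prop := Block {
  block_connected : connected B;
  block_sub : Z \subset B;
  block_neq0 : exists z, z \in Z;
  block_cut : forall F c v, c \in F -> F \subset B -> v \in B -> v \notin F ->
    cut_in B v F -> meets F Z
}.

Lemma rooted_block B W Z w : block B Z -> W \subset B -> w \in W -> rooted B W Z.
Proof.
move=> [cB sZ [z zZ] hB] sW wW; apply: (rooted_connected cB sW sZ wW zZ).
move=> F c v cF FB vB vF ctF; have [x xF xZ] := hB F c v cF FB vB vF ctF.
by exists x; rewrite // inE xZ orbT.
Qed.

(** For [k <= 1] any walk will do, so no degree is asked for; truncated differences can then be used
    as the number of paths. *)
Definition induction_hypothesis n : Prop :=
  forall k A X Y, #|A| < n -> rooted A X Y -> (exists a, a \in A) ->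
    (1 < k -> forall v, v \in A -> k < rdeg A X Y v) -> good k A X Y.

(** Each length in the core has to work for all [w] in [W] at once, because the walks in [B] may
    start at different vertices of [W]. *)
Lemma good_attach_rooted n k m B Z X D W w0 :
  induction_hypothesis n -> #|B| < n -> rooted B W Z -> w0 \in B ->
  [disjoint D & B] ->
  admissible m (fun l => forall w, w \in W -> exists u, e w u /\ lengths D X [set u] l) ->
  (forall w, w \in B -> k < m.-1 + rdeg B W Z w) ->
  admissible k (lengths (D :|: B) X Z).
Proof.
move=> IH Bn rB w0B dD Hm Hd.
have H : good (k - m.-1) B W Z.
  apply: IH => //; first by exists w0.
  by move=> k1 v vB; have := Hd v vB; move: k1; nlia.
have := admissible_add _ Hm H; move/(_ (lengths (D :|: B) X Z)) => HH.
apply: admissible_le (HH _); first by nlia.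
by move=> i j Hi Hj; apply: lengths_cat Hi Hj.
Qed.

Lemma good_attach n k m B Z X D W w0 :
  induction_hypothesis n -> #|B| < n -> block B Z -> W \subset B -> w0 \in W ->
  [disjoint D & B] ->
  admissible m (fun l => forall w, w \in W -> exists u, e w u /\ lengths D X [set u] l) ->
  (forall w, w \in B -> k < m.-1 + rdeg B W Z w) ->
  admissible k (lengths (D :|: B) X Z).
Proof.
move=> IH Bn hB sW w0W.
exact: good_attach_rooted IH Bn (rooted_block hB sW w0W) (subsetP sW _ w0W).
Qed.

(* Attach B through the vertices adjacent to both S and T, which are reached
   with all lengths up to 2|S|+1; if there are none, through T or through S,
   which are reached with lengths of a fixed parity. *)
Lemma good_core n k B Z X S T :
  induction_hypothesis n -> #|B| < n -> block B Z ->
  [disjoint S & T] -> {in S & T, forall a t, e a t} -> #|S| < #|T| -> T \subset X ->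
  [disjoint S :|: T & B] -> meets B (Nbrs (S :|: T)) ->
  (forall w, w \in B -> deg T w <= #|S|.+1) ->
  (forall w, w \in B -> deg T w * (w \in X) = 0 /\ deg S w + (w \in X) <= #|S|) ->
  (forall w, w \in B -> k < deg B w + (deg S w + deg T w) + (w \in X) + (w \in Z)) ->
  admissible k (lengths ((S :|: T) :|: B) X Z) \/
  [/\ #|S| = 1, ~ meets B (Nbrs T), meets B (Nbrs S) & meets B X].
Proof.
move=> IH Bn hB dST eST cST TX dB [w0 w0B w0N] hT hX hd.
have even t i : t \in T -> i <= #|S| -> lengths (S :|: T) X [set t] (1 + 2 * i).
  move=> tT iS; apply: lengths_sub TX (subxx _) (zigzag dST eST tT iS _) => //.
  by move: iS cST; nlia.
have odd a i : a \in S -> i < #|S| -> lengths (S :|: T) X [set a] (2 + 2 * i).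
  move=> aS iS; apply: lengths_sub TX (subxx _) (zigzag_odd dST eST aS iS _) => //.
  by move: iS cST; nlia.
have NbrsE w U : w \in Nbrs U -> exists2 u, u \in U & e w u.
  by case/NbrsP=> u uU; rewrite sym_e; exists u.
case: (classic (exists w, [/\ w \in B, w \in Nbrs S & w \in Nbrs T])).
  move=> [w1 [w1B w1S w1T]]; left; pose W := B :&: Nbrs S :&: Nbrs T.
  have S0 : 0 < #|S|.
    by apply: leq_trans (deg_Nbrs_gt0 w1S) (deg_le_card _ _).
  (* A vertex of [W] has at most [2 * #|S| + 1] edges to [S], [T] and x, one of which survives as a
     root edge; any other vertex of [B] has at most [2 * #|S|]. *)
  apply: (@good_attach n k (2 * #|S|).+1 B Z X _ W w1) => //.
  - by rewrite /W -setIA subsetIl.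
  - by rewrite !inE w1B w1S.
  - suff H l w : 0 < l <= (2 * #|S|).+1 -> w \in W ->
        exists u, e w u /\ lengths (S :|: T) X [set u] l.
      exists 1, 1; split; first (by left).
        by move=> w; apply: H.
      by move=> i iS w; apply: H; move: iS; nlia.
    move=> lS; rewrite !in_setI => /andP[/andP[wB wS] wT].
    have [[i [iS ->]]|[i [iS ->]]] : (exists i, i <= #|S| /\ l = 1 + 2 * i) \/
        (exists i, i < #|S| /\ l = 2 + 2 * i).
    + case: (boolP (ssrnat.odd l)) => ol; [left; exists l./2 | right; exists l./2.-1];
      by move: lS ol; nlia.
    + by have [t tT ewt] := NbrsE _ _ wT; exists t; split=> //; apply: even.
    + by have [a aS ewa] := NbrsE _ _ wS; exists a; split=> //; apply: odd.
  - move=> w wB; have := hd w wB; have := hT w wB; have [] := hX w wB.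
    rewrite /rdeg !in_setI wB /=.
    have := deg_Nbrs S w; have := deg_Nbrs T w; have := Nbrs_deg T w.
    by move: S0; case: (w \in X); case: (w \in Nbrs S); case: (w \in Nbrs T);
      rewrite /= ?muln0 ?muln1; nlia.
move=> nM; case: (classic (meets B (Nbrs T))) => [[w1 w1B w1T]|nT].
  (* Walks ending in [T] have odd length, one for each [i] from 0 to [#|S|]. *)
  left; apply: (@good_attach n k #|S|.+1 B Z X _ (B :&: Nbrs T) w1) => //.
  - exact: subsetIl.
  - by rewrite inE w1B.
  - exists 1, 2; split; first (by right).
      move=> w /setIP[_ /NbrsE[t tT ewt]]; exists t; split=> //.
      exact: (even t 0).
    move=> i iS w /setIP[_ /NbrsE[t tT ewt]]; exists t; split=> //.
    exact: even.
  - move=> w wB; have := hd w wB; have := hT w wB; have [] := hX w wB.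
    rewrite /rdeg !in_setI wB /=.
    have := deg_Nbrs S w; have := deg_Nbrs T w; have := Nbrs_deg T w.
    have : ~~ ((w \in Nbrs S) && (w \in Nbrs T)).
      by apply/negP=> /andP[? ?]; apply: nM; exists w.
    by case: (w \in X); case: (w \in Nbrs S); case: (w \in Nbrs T);
      rewrite /= ?muln0 ?muln1 //; nlia.
have [w1 w1B w1S] : meets B (Nbrs S).
  exists w0 => //; case/NbrsP: w0N => u; rewrite inE => /orP[uS|uT] euw.
    by apply/NbrsP; exists u.
  by case: nT; exists w0 => //; apply/NbrsP; exists u.
have S0 : 0 < #|S|.
  by apply: leq_trans (deg_Nbrs_gt0 w1S) (deg_le_card _ _).
(* Walks ending in [S] have only [#|S|] lengths. A vertex of [X] without neighbours in [S] loses its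
   edge to x, and the allowance [#|S| - 1] fails to cover this only if [#|S|] is 1. *)
case: (classic (meets B X /\ #|S| = 1)) => [[BX S1]|nX].
  by right; split=> //; exists w1.
left; apply: (@good_attach n k #|S| B Z X _ (B :&: Nbrs S) w1) => //.
- exact: subsetIl.
- by rewrite inE w1B.
- exists 2, 2; split; first (by right).
    move=> w /setIP[_ /NbrsE[a aS ewa]]; exists a; split=> //.
    exact: (odd a 0).
  move=> i iS w /setIP[_ /NbrsE[a aS ewa]]; exists a; split=> //.
  exact: odd.
move=> w wB; have := hd w wB; have [_] := hX w wB.
have -> : deg T w = 0 by apply: deg_eq0; apply/negP=> wT; apply: nT; exists w.
rewrite /rdeg !in_setI wB /=; have := deg_Nbrs S w.
have : (w \in X) < #|S|.
  case: (boolP (w \in X)) => // wX; have : #|S| <> 1.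
    by move=> S1; apply: nX; split=> //; exists w.
  by move: S0; nlia.
by move: S0; case: (w \in X); case: (w \in Nbrs S); rewrite /= ?muln0 ?muln1; nlia.
Qed.

Lemma ex_max_card (P : {set V} -> Prop) S0 : P S0 ->
  exists S, P S /\ forall S', P S' -> #|S'| <= #|S|.
Proof.
move: {2}(#|V| - #|S0|) (leqnn (#|V| - #|S0|)) => m.
elim: m S0 => [|m IH] S0 hm P0.
  by exists S0; split=> // S' _; have : #|S'| <= #|V| := max_card _; move: hm; nlia.
case: (classic (exists S', P S' /\ #|S0| < #|S'|)) => [[S' [PS' lt]]|N].
  by apply: (IH S') => //; have : #|S'| <= #|V| := max_card _; move: hm lt; nlia.
exists S0; split=> // S' PS'; rewrite leqNgt; apply/negP=> lt.
by apply: N; exists S'.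
Qed.

Lemma ex_min_card (P : {set V} -> Prop) S0 : P S0 ->
  exists S, P S /\ forall S', P S' -> #|S| <= #|S'|.
Proof.
move: {2}#|S0| (leqnn #|S0|) => m.
elim: m S0 => [|m IH] S0 hm P0; first by exists S0; split=> // S' _; move: hm; nlia.
case: (classic (exists S', P S' /\ #|S'| < #|S0|)) => [[S' [PS' lt]]|N].
  by apply: (IH S') => //; move: hm lt; nlia.
exists S0; split=> // S' PS'; rewrite leqNgt; apply/negP=> lt.
by apply: N; exists S'.
Qed.

(* B is a smallest part of E that some vertex b separates from Y, if there is
   one; minimality makes B + b 2-connected. *)
Lemma end_block E Y y0 : connected E -> y0 \in E -> y0 \in Y ->
  exists B Z, [/\ block B Z, B \subset E,
    forall w, w \in B -> deg E w + (w \in Y) <= deg B w + (w \in Z),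
    exists r, forall D X l, [disjoint D & E] -> lengths (D :|: B) X Z l ->
      lengths (D :|: E) X Y (l + r)
    & B = E \/ exists b, [/\ b \in E, b \notin B, cut_in E b B, Z = nbrs b :&: B & ~ meets B Y]].
Proof.
move=> cE yE yY.
pose P F := exists b c, [/\ c \in F, F \subset E, b \in E /\ b \notin F, cut_in E b F & ~ meets F Y].
case: (classic (exists F, P F)) => [[F0 /ex_min_card[B [PB minB]]]|nP]; last first.
  exists E, (Y :&: E); split=> //; last by left.
  - split=> //; [exact: subsetIr | by exists y0; rewrite inE yY |].
    move=> F c v cF FE vE vF ctF; case: (classic (meets F Y)) => [[x xF xY]|N].
      by exists x; rewrite // inE xY (subsetP FE).
    by case: nP; exists F, v, c.
  - by move=> w wE; rewrite inE wE andbT.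
  - exists 0 => D X l _ Hl; rewrite addn0; apply: lengths_sub Hl => //.
    exact: subsetIl.
have [b [c [cB BE [bE bB] ctB nBY]]] := PB.
have sub F x : x \in F -> F \subset B -> cut_in E b F -> F = B.
  move=> xF FB ctF; apply/eqP; rewrite eqEcard FB minB //; exists b, x; split=> //.
  - exact: subset_trans FB BE.
  - by split=> //; apply: contra bB; apply: (subsetP FB).
  - by move=> [y yF yY']; apply: nBY; exists y; rewrite // (subsetP FB).
have conB : connected B.
  move=> F x xF FB clF; rewrite -(sub F x) // => u w uF wE euw wb.
  by apply: (clF u) => //; apply: (ctB u) => //; apply: (subsetP FB).
have cutb F x v : x \in F -> F \subset B -> v \in E -> v \notin F -> v \in B -> cut_in B v F -> meets F (nbrs b :&: B).
  move=> xF FB vE vF vB ctF; case: (classic (meets F (nbrs b))) => [[y yF yb]|N].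
    by exists y; rewrite // inE yb (subsetP FB).
  have PF : P F.
    exists v, x; split=> //; first exact: subset_trans FB BE.
      move=> u w uF wE euw wv; apply: (ctF u) => //; apply: (ctB u) => //.
        exact: (subsetP FB).
      by apply/eqP=> Ew; case: N; exists u; rewrite // inE sym_e -Ew.
    by move=> [y yF yY']; apply: nBY; exists y; rewrite // (subsetP FB).
  have := minB F PF; rewrite leqNgt proper_card // properE FB.
  by apply/subsetPn; exists v.
have [z zB ebz] : exists2 z, z \in B & e b z.
  case: (classic (exists2 z, z \in B & e b z)) => // N.
  case/negP: bB; rewrite -(cE B c) // => u w uB wE euw; apply: (ctB u) => //.
  by apply/eqP=> Ew; apply: N; exists u; rewrite // sym_e -Ew.
exists B, (nbrs b :&: B); split=> //.
- split=> //; [exact: subsetIr | by exists z; rewrite !inE ebz |].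
  by move=> F x v xF FB vB vF; apply: (cutb F x v) => //; apply: (subsetP BE).
- move=> w wB; have -> : (w \in Y) = false by apply/negP=> wY; apply: nBY; exists w.
  have : deg E w <= deg B w + deg [set b] w.
    apply: deg_cover => x xE ewx; rewrite in_set1; case: eqVneq => [|xb]; first by rewrite orbT.
    by rewrite (ctB w).
  by rewrite deg_set1 !inE wB (sym_e w); nlia.
- have bEB : b \in E :\: B by rewrite inE bB.
  have [F [bF FEB clF cF]] := component bEB.
  (* The component of [b] outside [B] is everything outside [B], so it contains [y0]; one walk from
     [b] to [y0] prolongs all walks that leave [B]. *)
  have EFB : E = F :|: B.
    apply: (cE _ b); first by rewrite inE bF.
      by rewrite subUset BE (subset_trans FEB) // subsetDl.
    move=> u w; rewrite !inE => uFB wE euw; case: (boolP (w \in B)) => wB; first by rewrite orbT.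
    rewrite orbF; case/orP: uFB => [uF|uB]; first by apply: (clF u); rewrite // inE wB.
    by have [->//|wb] := eqVneq w b; rewrite (ctB u w) in wB.
  have yF : y0 \in F.
    move: (yE); rewrite {1}EFB inE => /orP[//|yB]; by case: nBY; exists y0.
  have [r W] := connected_walk cF bF yF.
  exists r => D X l dD Hl.
  have Hr : lengths (E :\: B) [set b] Y r.
    by exists b, y0; split; rewrite ?set11 //; apply: walk_sub W.
  have dDB : [disjoint D :|: B & E :\: B].
    apply/pred0P=> x /=; apply/negbTE; rewrite !inE; apply/negP=> /andP[/orP[xD|->//] /andP[_ xE]].
    by rewrite (disjointFr dD xD) in xE.
  have sb : nbrs b :&: B \subset nbrs b :&: (D :|: B) by apply/setIS/subsetUr.
  apply: lengths_sub (lengths_cat_vertex dDB (lengths_sub (subxx _) (subxx _) sb Hl) Hr) => //.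
  by rewrite !subUset subsetUl !(subset_trans _ (subsetUr D E)) // subsetDl.
- by right; exists b.
Qed.

(** * Robust pairs and the exceptional bipartite core *)

Lemma disjoint_setUl A B C :
  [disjoint A :|: B & C] = [disjoint A & C] && [disjoint B & C].
Proof. by rewrite -!setI_eq0 setIUl setU_eq0. Qed.

(** What remains after the reduction at cut vertices: a part cut off in [A] sees both roots, where
    [rooted_cut] promises only one. *)
Record robust A X Y : Prop := Robust {
  robust_rooted : rooted A X Y;
  robust_connected : connected A;
  robust_cut : forall C c v, c \in C -> C \subset A -> v \in A -> v \notin C ->
    cut_in A v C -> meets C X /\ meets C Y
}.

Lemma connected_sub_closed C D F : connected C -> C \subset D -> closed_in D F ->
  meets C F -> C \subset F.
Proof.
move=> cC CD clF [c cC' cF]; rewrite (cC (C :&: F) c) ?subsetIr ?subsetIl ?inE ?cC' //.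
move=> u w /setIP[uC uF] wC euw; rewrite inE wC /=.
by apply: (clF u) => //; apply: (subsetP CD).
Qed.

(* Paths from x to a on the side of t lose only the root y, and paths from a to
   y in E lose only the root x. *)
Lemma good_cut_vertex n k A X Y a t E y0 :
  induction_hypothesis n -> #|A| <= n -> 2 < k -> robust A X Y ->
  (forall v, v \in A -> k < rdeg A X Y v) ->
  a \in A -> t \in X -> e a t -> E \subset A :\ a -> t \notin E -> y0 \in E -> y0 \in Y ->
  closed_in (A :\ a) E -> connected E -> good k A X Y.
Proof.
move=> IH An k2 [rA cA ctA] dA aA tX eat EA tE yE yY clE cE.
have EA' := subset_trans EA (subsetDl _ _).
have aE : a \notin E by apply/negP=> /(subsetP EA); rewrite !inE eqxx.
have EnA : ~ closed_in A E by move=> clA; rewrite -(cA E y0) ?aA in aE.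
have rE : rooted E (Nbrs [set a] :&: E) (Y :&: E).
  apply: (rooted_component EA clE cE yE yY EnA) => F c v cF FE vA vF ctF.
  by have [] := ctA F c v cF (subset_trans FE EA') vA vF ctF.
have En : #|E| < n.
  by apply: leq_trans An; apply: proper_card; rewrite properE EA'; apply/subsetPn; exists a.
(* A vertex of [E] keeps its edge to [a] as a root edge and loses at most the one to x. *)
have gE : good (k - 1) E (Nbrs [set a] :&: E) (Y :&: E).
  apply: IH => //; first by exists y0.
  move=> _ v vE; have := dA v (subsetP EA' v vE).
  have := deg_component clE vE; have := deg_Nbrs [set a] v; rewrite deg_set1.
  rewrite /rdeg !in_setI vE !andbT.
  by move: k2; case: (v \in Nbrs _); case: (v \in X); case: (e v a); nlia.
have at_ : t != a by apply: contraTneq eat => ->; rewrite irr_e.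
have tA : t \in A :\ a by rewrite !inE at_ (subsetP (rooted_subl rA)).
have [F [tF FA clF cF]] := component tA.
have FA' := subset_trans FA (subsetDl _ _).
have aF : a \notin F by apply/negP=> /(subsetP FA); rewrite !inE eqxx.
have dFE : [disjoint F & E].
  apply/pred0P=> x /=; apply/negP=> /andP[xF xE].
  have: F \subset E by apply: (connected_sub_closed cF FA clE); exists x.
  by move/subsetP/(_ t tF); rewrite (negPf tE).
have rF : rooted F (X :&: F) (nbrs a :&: F).
  apply: (@rooted_connected _ _ _ t t) => //; rewrite ?subsetIr // ?inE ?tX ?tF ?eat //.
  move=> G c v cG GF vF vG ctG.
  have [ctGA|[u [w [uG /setIP[_ /set1P->] eua]]]] := cut_or_adj clF GF ctG.
    have [[x xG xX] _] := ctA G c v cG (subset_trans GF FA') (subsetP FA' v vF) vG ctGA.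
    by exists x; rewrite // !inE xX (subsetP GF x xG).
  by exists u; rewrite // !inE (subsetP GF u uG) (sym_e a) eua orbT.
(* In [F] only the edge to y is lost, so degree 3 remains as [k] exceeds 2. *)
have gF : good 2 F (X :&: F) (nbrs a :&: F).
  apply: (@good2_exceptional _ _ _ _ a (leqnn _)) => //; last by exists t.
  move=> v vF _; have := dA v (subsetP FA' v vF).
  have := deg_component clF vF; rewrite deg_set1 /rdeg !in_setI vF !andbT inE (sym_e a).
  by move: k2; case: (v \in X); case: (v \in Y); case: (e v a); nlia.
have gFa : admissible 2 (lengths (F :|: [set a]) X [set a]).
  apply: (admissible_impl (r := 1)) gF => l Hl.
  have da : [disjoint F & [set a]] by rewrite disjoint_sym disjoints1.
  apply: lengths_sub (lengths_cat_vertex da Hl (lengths_self (set11 a) (subxx _))) => //.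
  exact: subsetIl.
have dE : [disjoint F :|: [set a] & E].
  by rewrite disjoint_setUl dFE disjoints1.
have H1 i j : lengths (F :|: [set a]) X [set a] i ->
    lengths E (Nbrs [set a] :&: E) (Y :&: E) j -> lengths A X Y (i + j).
  move=> Hi Hj; apply: lengths_sub (lengths_cat_set dE _ Hj) => //.
  - by rewrite !subUset FA' EA' sub1set aA.
  - exact: subsetIl.
  - by move=> u /set1P->.
apply: admissible_le (admissible_add H1 gFa gE); move: k2; nlia.
Qed.

(* k - 1 paths from x to b run through B, ignoring a; two more from b to y avoid
   B. For the latter a has lost degree, and it may be separated from b and y by
   a vertex v: then the largest such part J is dropped and v is exceptional. *)
Lemma good_bad_block n k A X Y a T E B Z b y0 :
  induction_hypothesis n -> #|A| <= n -> 2 < k -> robust A X Y ->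
  (forall v, v \in A -> k < rdeg A X Y v) ->
  T \subset A -> a \in A -> (forall t, t \in T -> e a t) ->
  E \subset A :\: (a |: T) -> closed_in (A :\: (a |: T)) E -> connected E ->
  y0 \in E -> y0 \in Y -> meets E (Nbrs T) ->
  block B Z -> B \subset E -> b \in E -> b \notin B -> cut_in E b B ->
  Z = nbrs b :&: B -> ~ meets B Y -> ~ meets B (Nbrs T) -> meets B X ->
  good k A X Y.
Proof.
move=> IH An k2 [rA cA ctA] dA TA aA eaT EA clE cE yE yY [w0 w0E /NbrsP[t0 t0T et0]]
  hB BE bE bB ctB defZ nBY nBT [x0 x0B x0X].
have EA' := subset_trans EA (subsetDl _ _); have BA := subset_trans BE EA'.
have bA := subsetP EA' b bE.
have nEH x : x \in E -> x \notin a |: T by move/(subsetP EA); rewrite inE => /andP[].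
have aE : a \notin E by apply/negP=> /nEH; rewrite setU11.
have TE t : t \in T -> t \notin E by move=> tT; apply/negP=> /nEH; rewrite !inE tT orbT.
have aB : a \notin B by apply: contra aE; apply: (subsetP BE).
have ab : a != b by apply: contraNneq aE => ->.
have Bn : #|B| < n.
  by apply: leq_trans An; apply: proper_card; rewrite properE BA; apply/subsetPn; exists b.
(* Within [A], edges leave [B] only towards [a] and [b]. *)
have nB u w : u \in B -> w \in A -> e u w -> [|| w \in B, w == a | w == b].
  move=> uB wA euw; case: (boolP (w \in a |: T)) => [|wH].
    rewrite in_setU1 => /orP[->|wT]; first by rewrite orbT.
    by case: nBT; exists u => //; apply/NbrsP; exists w; rewrite // sym_e.
  have wE : w \in E by apply: (clE u); rewrite ?inE ?(subsetP BE) // -in_setU1 wH.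
  by have [->|wb] := eqVneq w b; rewrite ?orbT // (ctB u).
have gB : good (k - 1) B (X :&: B) Z.
  apply: IH => //; first by apply: (rooted_block hB (subsetIr _ _) (w := x0)); rewrite inE x0X.
    by exists x0.
  move=> _ v vB; have := dA v (subsetP BA v vB).
  have : deg A v <= deg B v + deg [set a; b] v.
    by apply: deg_cover => w wA evw; rewrite in_set2; apply: nB evw.
  have := deg_subU v (subxx [set a; b]); rewrite !deg_set1 /rdeg.
  have -> : (v \in Y) = false by apply/negP=> vY; apply: nBY; exists v.
  rewrite defZ !in_setI vB !andbT inE (sym_e b).
  by move: k2; case: (e v a); nlia.
suff gb : admissible 2 (lengths (A :\: B) [set b] Y).
  have dB : [disjoint B & A :\: B] by rewrite -setI_eq0 setIDA setIC -setIDA setDv setI0.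
  have H1 i j : lengths B (X :&: B) Z i -> lengths (A :\: B) [set b] Y j ->
      lengths A X Y (i + j).
    rewrite defZ => Hi Hj; apply: lengths_sub (lengths_cat_vertex dB Hi Hj) => //.
      by rewrite subUset BA subsetDl.
    exact: subsetIl.
  by apply: admissible_le (admissible_add H1 gB gb); move: k2; nlia.
pose D := A :\: (b |: B).
have DA : D \subset A := subsetDl _ _.
have inD w : w \in A -> w != b -> w \notin B -> w \in D.
  by move=> wA wb wB; rewrite inE in_setU1 negb_or wb wB.
have DP w : w \in D -> [/\ w \in A, w != b & w \notin B].
  by rewrite inE in_setU1 negb_or => /andP[/andP[]].
have aD : a \in D by apply: inD.
have DnB v w : v \in D -> v != a -> w \in B -> e v w -> False.
  move=> /DP[vA vb vB] va wB evw.
  by have := nB w v wB vA; rewrite sym_e evw (negPf va) (negPf vb) (negPf vB) => /(_ isT).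
(* Without [a] and without neighbours of [b], the part [F] sends no edges to [B] or [b], so it is
   cut off in [A] as well. *)
have cutA F v : F \subset D -> a \notin F -> ~ meets F (nbrs b) -> cut_in D v F -> cut_in A v F.
  move=> FD aF nFb ctF u w uF wA euw wv.
  have uD := subsetP FD u uF; have ua : u != a by apply: contraNneq aF => <-.
  apply: (ctF u) => //; apply: inD => //.
    by apply/eqP=> Ew; apply: nFb; exists u; rewrite // inE sym_e -Ew.
  by apply/negP=> wB; apply: (DnB u w).
have toY F c v : c \in F -> F \subset D -> v \in A -> v \notin F -> a \notin F ->
    ~ meets F (nbrs b) -> cut_in D v F -> meets F Y.
  move=> cF FD vA vF aF nFb ctF.
  by have [] := ctA F c v cF (subset_trans FD DA) vA vF (cutA F v FD aF nFb ctF).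
(* Apart from [a], vertices of [D] have no edges to [B] and keep the one to [b]; forgetting x still
   leaves degree 3. *)
have degO O v : O \subset D -> v \in O -> v != a ->
    (forall w, w \in D -> e v w -> w \in O) -> 2 < rdeg O (nbrs b :&: O) (Y :&: O) v.
  move=> OD vO va cO; have vD := subsetP OD v vO; have := dA v (subsetP DA v vD).
  have : deg A v <= deg O v + deg [set b] v.
    apply: deg_cover => w wA evw; rewrite in_set1; have [|wb] := eqVneq w b; first by rewrite orbT.
    rewrite cO //; apply: inD => //; apply/negP=> wB; exact: (DnB v w).
  rewrite deg_set1 /rdeg !in_setI vO !andbT inE (sym_e b).
  by move: k2; case: (v \in X); nlia.
have toB O : O \subset D -> good 2 O (nbrs b :&: O) (Y :&: O) ->
    admissible 2 (lengths (A :\: B) [set b] Y).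
  move=> OD; apply: (admissible_impl (r := 1)) => l Hl; rewrite addnC.
  have bO : [disjoint [set b] & O].
    by rewrite disjoints1; apply/negP=> /(subsetP OD)/DP[_]; rewrite eqxx.
  have Hb u : u \in [set b] -> lengths [set b] [set b] [set u] 1.
    by move=> ub; apply: lengths_self.
  have sb : nbrs b :&: O \subset Nbrs [set b] :&: O.
    by apply/setSI/subsetP=> w; rewrite inE => ebw; apply/NbrsP; exists b; rewrite ?set11.
  apply: lengths_sub (lengths_cat_set bO Hb (lengths_sub (subxx _) sb (subxx _) Hl)) => //.
    rewrite subUset sub1set inE bA bB; apply/subsetP=> w /(subsetP OD)/DP[wA _ wB].
    by rewrite inE wB.
  exact: subsetIl.
have [O1 [aO1 O1D clO1 cO1]] := component aD.
(* If [D] is not connected, a component that avoids [a], and hence its loss of degree, suffices. *)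
case: (boolP (D \subset O1)) => [DO1|/subsetPn[u uD uO1]]; last first.
  have [O [uO OD clO cO]] := component uD.
  have aO : a \notin O.
    apply/negP=> aO; have: O \subset O1 by apply: (connected_sub_closed cO OD clO1); exists a.
    by move/subsetP/(_ u uO); rewrite (negPf uO1).
  have bO : b \notin O by apply/negP=> /(subsetP OD)/DP[_]; rewrite eqxx.
  have OA := subset_trans OD DA.
  have [x xO xb] : meets O (nbrs b).
    case: (classic (meets O (nbrs b))) => // N; case/negP: bO; rewrite -(cA O u) //.
    move=> v w vO wA evw; have [Ew|wb] := eqVneq w b.
      by case: N; exists v; rewrite // inE sym_e -Ew.
    apply: (clO v) => //; apply: inD => //; apply/negP=> wB.
    by apply: (DnB v w) => //; [apply: (subsetP OD) | apply: contraNneq aO => <-].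
  have [|_ [y yO yY']] := ctA O u b uO OA bA bO.
    move=> v w vO wA evw wb; apply: (clO v) => //; apply: inD => //; apply/negP=> wB.
    by apply: (DnB v w) => //; [apply: (subsetP OD) | apply: contraNneq aO => <-].
  apply: (toB O OD); apply: (@good2_exceptional _ _ _ _ a (leqnn _)) => //.
  - apply: (@rooted_connected _ _ _ x y) => //; rewrite ?subsetIr // ?in_setI ?xb ?yY' //.
    move=> F c v cF FO vO vF ctF; case: (classic (meets F (nbrs b))) => [[z zF zb]|nFb].
      by exists z; rewrite // in_setU !in_setI zb (subsetP FO).
    have [||z zF zY] := toY F c v cF (subset_trans FO OD) (subsetP OA v vO) vF _ nFb.
    + by apply: contra aO; apply: (subsetP FO).
    + by move=> f w fF wD efw wv; apply: (ctF f) => //; apply: (clO f) => //; apply: (subsetP FO).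
    by exists z; rewrite // in_setU !in_setI zY (subsetP FO) ?orbT.
  - move=> v vO va; apply: degO => // w wD evw; exact: (clO v).
  - by exists u; rewrite //; apply: contraNneq aO => <-.
have EO1 : O1 = D by apply/eqP; rewrite eqEsubset O1D.
have cD : connected D by rewrite -EO1.
(* The edge from [t0] to [w0] links [D] with [E]. If [b] is not [w0] and has no neighbour in [D],
   then [E] without [B] and [b] is closed in [E], against connectedness. *)
have [x1 x1D x1b] : meets D (nbrs b).
  have [t0D|t0D] := boolP (t0 \in D); last first.
    case/negP: t0D; apply: inD; first exact: (subsetP TA).
      by apply: contraNneq (TE t0 t0T) => ->.
    by apply: contra (TE t0 t0T); apply: (subsetP BE).
  have [Ew|wb] := eqVneq w0 b; first by exists t0; rewrite // inE -Ew sym_e.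
  case: (classic (meets D (nbrs b))) => // N.
  have w0B : w0 \notin B.
    by apply/negP=> w0B; apply: nBT; exists w0 => //; apply/NbrsP; exists t0.
  have: b \in E :\: (b |: B).
    rewrite -(cE (E :\: (b |: B)) w0) //; last 2 first.
    - exact: subsetDl.
    - move=> v w; rewrite !in_setD !in_setU1 !negb_or => /andP[/andP[vb vB] vE] wE evw.
      rewrite wE andbT; have vD : v \in D by apply: inD => //; apply: (subsetP EA').
      apply/andP; split; first by apply/eqP=> Ew; apply: N; exists v; rewrite // inE sym_e -Ew.
      apply/negP=> wB; apply: (DnB v w) => //; by apply: contraNneq aE => <-.
    by rewrite in_setD in_setU1 negb_or wb w0B w0E.
  by rewrite in_setD setU11.
have [y1 y1D y1Y] : meets D Y.
  have [||//|||_ [y yA yY']] := ctA (A :\ b) a b.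
  - by rewrite !inE ab.
  - exact: subsetDl.
  - by rewrite !inE eqxx.
  - by move=> u w _ wA _ wb; rewrite !inE wb.
  exists y => //; move: yA => /setD1P[yb yA]; apply: inD => //.
  by apply/negP=> yB; apply: nBY; exists y.
(* Parts of [D] that a vertex separates from both [b] and y. Each contains [a]: otherwise it would
   be cut off in [A] and meet [Y]. *)
pose P J := exists v j, [/\ j \in J, J \subset D, v \in D /\ v \notin J, cut_in D v J
   & ~ meets J (nbrs b) /\ ~ meets J Y].
have aP J : P J -> a \in J.
  move=> [v [j [jJ JD [vD vJ] ctJ [nJb nJY]]]]; apply: contraT => aJ; case: nJY.
  by apply: (toY J j v) => //; apply: (subsetP DA).
have t0D : t0 \in D.
  apply: inD; first exact: (subsetP TA).
    by apply: contraNneq (TE t0 t0T) => ->.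
  by apply: contra (TE t0 t0T); apply: (subsetP BE).
have t0a : t0 != a by apply: contraTneq (eaT t0 t0T) => ->; rewrite irr_e.
case: (classic (exists J, P J)) => [[J0 /ex_max_card[J [PJ maxJ]]]|nP]; last first.
  apply: (toB D) => //; apply: (@good2_exceptional _ _ _ _ a (leqnn _)) => //.
  - apply: (@rooted_connected _ _ _ x1 y1) => //; rewrite ?subsetIr // ?in_setI ?x1b ?y1Y //.
    move=> F c v cF FD vD vF ctF.
    case: (classic (meets F (nbrs b))) => [[z zF zb]|nFb].
      by exists z; rewrite // in_setU !in_setI zb (subsetP FD).
    case: (classic (meets F Y)) => [[z zF zY]|nFY].
      by exists z; rewrite // in_setU !in_setI zY (subsetP FD) ?orbT.
    by case: nP; exists F, v, c.
  - by move=> v vD va; apply: degO.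
  - by exists t0.
have aJ := aP J PJ; have [v [j [jJ JD [vD vJ] ctJ [nJb nJY]]]] := PJ.
pose O := D :\: J.
have OD : O \subset D := subsetDl _ _.
have inO w : w \in O -> w \in D /\ w \notin J by rewrite inE => /andP[].
have OJ u w : u \in O -> u != v -> w \in J -> e u w -> False.
  move=> /inO[uD uJ] uv wJ euw; case/negP: uJ; apply: (ctJ w) => //; by rewrite sym_e.
(* A closed part of [O] without [v] would be closed in [D]; one with [v] accounts, together with
   [J], for all of [D]. *)
have cO : connected O.
  move=> F c cF FO clF; have FD := subset_trans FO OD.
  have vF : v \in F.
    apply: contraT => vF; have DF : D = F.
      apply: (cD F c) => // u w uF wD euw; apply: (clF u) => //; rewrite inE wD andbT.
      apply/negP=> wJ; apply: (OJ u w) => //; first exact: (subsetP FO).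
      by apply: contraNneq vF => <-.
    have: j \in F by rewrite -DF (subsetP JD).
    by move/(subsetP FO)/inO => [_]; rewrite jJ.
  have DFJ : D = F :|: J.
    apply: (cD _ c); rewrite ?inE ?cF ?subUset ?FD //.
    move=> u w; rewrite !in_setU => uFJ wD euw; case: (boolP (w \in J)) => wJ; first by rewrite orbT.
    rewrite orbF; case/orP: uFJ => [uF|uJ]; first by apply: (clF u); rewrite // inE wJ.
    by have [->//|wv] := eqVneq w v; rewrite (ctJ u w) in wJ.
  apply/eqP; rewrite eqEsubset FO andbT; apply/subsetP=> w /inO[].
  by rewrite DFJ in_setU => /orP[//|->].
have x1O : x1 \in O by rewrite inE x1D andbT; apply/negP=> xJ; apply: nJb; exists x1.
have y1O : y1 \in O by rewrite inE y1D andbT; apply/negP=> yJ; apply: nJY; exists y1.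
(* If only [v] is left, it is adjacent to [b] and to y. Deleting [v] must leave another neighbour of
   y, which can only be [b]; the two walks are [b] alone and [b], [v]. *)
case: (classic (exists2 w, w \in O & w != v)) => [Ov|nOv]; last first.
  have Ov w : w \in O -> w = v.
    by move=> wO; apply/eqP; apply: contraT => wv; case: nOv; exists w.
  have bY : b \in Y.
    have [|||||_ [y yA yY']] := ctA (A :\ v) a v.
    - by rewrite !inE aA andbT; apply: contraNneq vJ => <-.
    - exact: subsetDl.
    - exact: (subsetP DA).
    - by rewrite !inE eqxx.
    - by move=> u w _ wA _ wv; rewrite !inE wv.
    move: yA => /setD1P[yv yA]; have [<-//|yb] := eqVneq y b.
    have yD : y \in D.
      by apply: inD => //; apply/negP=> yB; apply: nBY; exists y.
    rewrite (Ov y) ?eqxx // in yv; rewrite inE yD andbT.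
    by apply/negP=> yJ; apply: nJY; exists y.
  have bAB : b \in A :\: B by rewrite inE bB.
  apply: (@admissible2 _ 1 1); first by left.
    by exists b, b; split; rewrite ?set11 //; apply: walk1.
  have [vA vb vB] := DP v vD.
  exists b, v; split; rewrite ?set11 //; first by rewrite -(Ov y1).
  have ebv : e b v by rewrite -(Ov x1) //; rewrite inE in x1b.
  have dbv : [disjoint [set b] & [set v]] by rewrite disjoints1 inE eq_sym.
  apply: walk_sub (walk_cat dbv (walk1 (set11 b)) ebv (walk1 (set11 v))).
  by rewrite subUset !sub1set bAB inE vB.
apply: (toB O OD); apply: (@good2_exceptional _ _ _ _ v (leqnn _)) => //; last first.
  move=> w wO wv; apply: degO => //; first by apply: contraTneq wO => ->; rewrite inE aJ.
  by move=> x xD ewx; rewrite inE xD andbT; apply/negP=> xJ; apply: (OJ w x).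
apply: (@rooted_connected _ _ _ x1 y1) => //; rewrite ?subsetIr // ?in_setI ?x1b ?y1Y //.
move=> F c w cF FO wO wF ctF; have FD := subset_trans FO OD.
case: (classic (meets F (nbrs b))) => [[z zF zb]|nFb].
  by exists z; rewrite // in_setU !in_setI zb (subsetP FO).
case: (classic (meets F Y)) => [[z zF zY]|nFY].
  by exists z; rewrite // in_setU !in_setI zY (subsetP FO) ?orbT.
have [wD wJ] := inO w wO.
have FJ x : x \in F -> x \notin J by move/(subsetP FO)/inO => [].
(* With [v] in it, [F] could be added to [J], against maximality. Without [v], it would satisfy [P]
   and contain [a], which lies in [J]. *)
have [vF|vF] := boolP (v \in F).
  have PFJ : P (F :|: J).
    exists w, c; split.
    - by rewrite inE cF.
    - by rewrite subUset FD.
    - by rewrite in_setU negb_or wF wJ.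
    - move=> u x; rewrite !in_setU => uFJ xD eux xw.
      case: (boolP (x \in J)) => xJ; first by rewrite orbT.
      rewrite orbF; case/orP: uFJ => [uF|uJ]; first by apply: (ctF u); rewrite // inE xJ.
      by have [->//|xv] := eqVneq x v; rewrite (ctJ u x) in xJ.
    - by split=> -[x]; rewrite in_setU => /orP[xF|xJ] h; [apply: nFb | apply: nJb | apply: nFY | apply: nJY]; exists x.
  have := maxJ _ PFJ; rewrite leqNgt proper_card // properE subsetUr /=.
  by apply/subsetPn; exists v; rewrite // in_setU vF.
have PF : P F.
  exists w, c; split=> // u x uF xD eux xw; apply: (ctF u) => //; rewrite inE xD andbT.
  apply/negP=> xJ; apply: (OJ u x) => //; first exact: (subsetP FO).
  by apply: contraNneq vF => <-.
by have := FJ a (aP F PF); rewrite aJ.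
Qed.

(* S and T - with x added to S - form the bipartite core. *)
Record bicore A X S T : Prop := Bicore {
  bicore_subS : S \subset A :\: X;
  bicore_subT : T \subset X;
  bicore_complete : {in S & T, forall a t, e a t};
  bicore_card : #|S| < #|T|;
  bicore_max : forall w, w \in A -> w \notin X -> w \notin S -> deg T w <= #|S|.+1;
  bicore_all : forall t, t \in X -> {in S, forall a, e a t} -> t \in T
}.

(** [S] is a largest set with more than [#|S|] common neighbours in [X], possibly empty, and [T]
    consists of all of these. A vertex with more than [#|S| + 1] neighbours in [T] could be added to
    [S]. *)
Lemma bicore_exists A X x : x \in X -> exists S T, bicore A X S T.
Proof.
move=> xX; pose common S := [set t in X | [forall a in S, e a t]].
have commonP S t : reflect (t \in X /\ {in S, forall a, e a t}) (t \in common S).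
  by rewrite inE; apply: (iffP andP) => -[tX h]; split=> //; apply/forall_inP.
have P0 : set0 \subset A :\: X /\ #|@set0 V| < #|common set0|.
  rewrite sub0set cards0; split=> //; apply/card_gt0P; exists x.
  by apply/commonP; split=> // a; rewrite inE.
have [S [[SA Sc] maxS]] :=
  ex_max_card (P := fun S => S \subset A :\: X /\ #|S| < #|common S|) P0.
exists S, (common S); split=> //.
- by apply/subsetP=> t /commonP[].
- by move=> a t aS /commonP[_ h]; apply: h.
- move=> w wA wX wS; rewrite leqNgt; apply/negP=> lt.
  have : #|w |: S| <= #|S|.
    apply: maxS; split; first by rewrite subUset sub1set inE wA wX.
    rewrite cardsU1 wS; apply: leq_trans lt _; apply/subset_leq_card/subsetP=> t.
    rewrite !in_setI => /andP[wt /commonP[tX h]]; apply/commonP; split=> // a.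
    by rewrite in_setU1 => /orP[/eqP->|/h//]; rewrite inE in wt.
  by rewrite cardsU1 wS add1n ltnn.
- by move=> t tX h; apply/commonP.
Qed.

Lemma deg_independent X v : {in X &, forall x1 x2, ~~ e x1 x2} -> v \in X -> deg X v = 0.
Proof.
move=> indX vX; apply/deg_eq0/negP=> /NbrsP[u uX euv].
by have := indX u v uX vX; rewrite euv.
Qed.

(** If a neighbour of y lies outside the core, an end block of its component is attached to the
    core. *)
Lemma good_or_bicore n k A X Y :
  induction_hypothesis n -> #|A| <= n -> 2 < k -> robust A X Y ->
  (forall v, v \in A -> k < rdeg A X Y v) ->
  {in X &, forall x1 x2, ~~ e x1 x2} -> (exists x, x \in X) ->
  good k A X Y \/ exists S T, bicore A X S T /\ Y \subset S :|: T.
Proof.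
move=> IH An k2 rob dA indX [x xX]; have [rA cA ctA] := rob.
have XA := rooted_subl rA.
have [S [T core]] := bicore_exists A xX.
have [SAX TX eST cST maxS allT] := core.
case: (boolP (Y \subset S :|: T)) => [YH|/subsetPn[y0 y0Y y0H]].
  by right; exists S, T.
left; have SA : S \subset A := subset_trans SAX (subsetDl _ _).
have TA := subset_trans TX XA.
have HA : S :|: T \subset A by rewrite subUset SA.
have y0A : y0 \in A :\: (S :|: T) by rewrite in_setD y0H (subsetP (rooted_subr rA)).
have [E [y0E EA clE cE]] := component y0A.
have [B [Z [hB BE degB [r exitB] alt]]] := end_block cE y0E y0Y.
have EA' := subset_trans EA (subsetDl _ _); have BA := subset_trans BE EA'.
have nEH w : w \in E -> w \notin S :|: T by move/(subsetP EA); rewrite in_setD => /andP[].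
have dHE : [disjoint S :|: T & E].
  by rewrite disjoint_sym disjoint_subset; apply/subsetP=> w /nEH.
have dHB : [disjoint S :|: T & B] by apply: disjointWr dHE.
have dST : [disjoint S & T].
  apply/pred0P=> w /=; apply/negP=> /andP[/(subsetP SAX)]; rewrite inE => /andP[wX _].
  by move/(subsetP TX); rewrite (negPf wX).
have [t tT] : exists t, t \in T by apply/card_gt0P; apply: leq_trans cST.
have tE : t \notin E by apply/negP=> /nEH; rewrite in_setU tT orbT.
have Bn : #|B| < n.
  apply: leq_trans An; apply: proper_card; rewrite properE BA; apply/subsetPn.
  by exists t; [apply: (subsetP TA) | apply: contra tE; apply: (subsetP BE)].
have adjB : meets B (Nbrs (S :|: T)).
  case: alt => [BE'|[b [bE bB ctB _ nBY]]].
    have [|clA|[u [w [uE /setIP[_ wH] euw]]]] := closed_or_adj clE (subxx E).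
    - by move=> u w _ wE _.
    - by case/negP: tE; rewrite -(cA E y0) // (subsetP TA).
    by exists u; rewrite ?BE' //; apply/NbrsP; exists w; rewrite // sym_e.
  have [ctBA|[u [w [uB /setIP[_ wH] euw]]]] := cut_or_adj clE BE ctB.
    have [z [zZ]] := block_neq0 hB; have zB := subsetP (block_sub hB) _ zZ.
    by have [_ []] := ctA B z b zB BA (subsetP EA' b bE) bB ctBA => y yB yY; case: nBY; exists y.
  by exists u => //; apply/NbrsP; exists w; rewrite // sym_e.
have hT w : w \in B -> deg T w <= #|S|.+1.
  move=> wB; case: (boolP (w \in X)) => wX.
    have := deg_independent indX wX; have := deg_sub w TX; nlia.
  apply: maxS => //; first exact: (subsetP BA).
  by have := nEH w (subsetP BE w wB); rewrite in_setU negb_or => /andP[].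
(* A vertex of [X] has no neighbour in the independent set [T], and it misses a vertex of [S], as
   [allT] would otherwise put it into [T]. *)
have hX w : w \in B -> deg T w * (w \in X) = 0 /\ deg S w + (w \in X) <= #|S|.
  move=> wB; case: (boolP (w \in X)) => wX; last by rewrite muln0 addn0 deg_le_card.
  have := deg_independent indX wX; have := deg_sub w TX => d1 d0; split; first by move: d1 d0; nlia.
  rewrite addn1 ltn_neqAle deg_le_card andbT; apply/negP=> /eqP dS.
  have := nEH w (subsetP BE w wB); rewrite in_setU negb_or => /andP[_ /negP]; apply.
  apply: allT => // a aS; have : nbrs w :&: S = S.
    by apply/eqP; rewrite eqEcard subsetIr -/(deg S w) dS /=.
  by move/setP/(_ a); rewrite !inE aS andbT sym_e.
have hd w : w \in B -> k < deg B w + (deg S w + deg T w) + (w \in X) + (w \in Z).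
  move=> wB; have := dA w (subsetP BA w wB); have := degB w wB.
  have := deg_component clE (subsetP BE w wB); have := deg_subU w (subxx (S :|: T)).
  by rewrite /rdeg; nlia.
case: (good_core IH Bn hB dST eST cST TX dHB adjB hT hX hd) => [H|[S1 nBT BS BX]].
  apply: admissible_impl H => l /(exitB _ _ _ dHE); apply: lengths_sub => //.
  by rewrite subUset HA.
have [a Sa] : exists a, S = [set a] by apply/cards1P; rewrite S1.
subst S; rewrite sub1set in SA.
have eat u : u \in T -> e a u by move=> uT; apply: eST; rewrite ?set11.
(* [B] has no edges to [T]. If [E] has some, then [B] is a proper part behind a vertex [b]; if not,
   [a] alone separates [E] from [T]. *)
case: (classic (meets E (Nbrs T))) => ET.
  case: alt => [BE'|[b [bE bB ctB defZ nBY]]]; first by case: nBT; rewrite BE'.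
  exact: (good_bad_block IH An k2 rob dA TA SA eat EA clE cE y0E y0Y ET hB BE bE bB).
have aE : a \notin E by apply/negP=> /nEH; rewrite setU11.
apply: (good_cut_vertex IH An k2 rob dA SA (subsetP TX t tT) (eat t tT) _ tE y0E y0Y _ cE).
  by rewrite subsetD1 EA' aE.
move=> u w uE /setD1P[wa wA] euw; case: (boolP (w \in T)) => wT.
  by case: ET; exists u => //; apply/NbrsP; exists w; rewrite // sym_e.
by apply: (clE u) => //; rewrite in_setD in_setU1 negb_or wa wT.
Qed.

Lemma lengths_end D X Y l : lengths D X Y l -> lengths D X (Y :&: D) l.
Proof.
by move=> [u [v [uX vY W]]]; exists u, v; rewrite inE vY; rewrite (walk_in W).2.
Qed.

(* Both roots have neighbourhood X. One vertex t of X is kept for the end of the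
   path, and S is shrunk to match the smaller side X - t. *)
Lemma good_twin n k A X S :
  induction_hypothesis n -> #|A| <= n -> 2 < k -> robust A X X ->
  (forall v, v \in A -> k < rdeg A X X v) ->
  {in X &, forall x1 x2, ~~ e x1 x2} -> (exists x, x \in X) ->
  bicore A X S X -> good k A X X.
Proof.
move=> IH An k2 [rA cA ctA] dA indX [t tX] [SAX _ eSX cSX maxS _].
have XA := rooted_subl rA; have tA := subsetP XA t tX.
have SA : S \subset A := subset_trans SAX (subsetDl _ _).
have degt := deg_independent indX tX.
pose U := X :\ t; have UX : U \subset X := subsetDl _ _.
have [t1 t1U] : exists t1, t1 \in U.
  have [w wA etw] : exists2 w, w \in A & e t w.
    by apply: deg_gt0; have := dA t tA; rewrite /rdeg tX; move: k2; nlia.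
  have [|||||[x xA xX] _] := ctA (A :\ t) w t => //.
  - by rewrite !inE wA andbT; apply: contraTneq etw => ->; rewrite irr_e.
  - exact: subsetDl.
  - by rewrite !inE eqxx.
  - by move=> u x _ xA _ xt; rewrite !inE xt.
  by exists x; move: xA => /setD1P[xt _]; rewrite !inE xt.
(* Removing [t] may destroy the strict inequality [#|S| < #|X|]; [S0] is a largest subset of [S]
   that restores it for [U]. *)
have P0 : set0 \subset S /\ #|@set0 V| < #|U|.
  by rewrite sub0set cards0; split=> //; apply/card_gt0P; exists t1.
have [S0 [[S0S cS0] maxS0]] := ex_max_card (P := fun S' => S' \subset S /\ #|S'| < #|U|) P0.
have S0A := subset_trans S0S SA.
have eSU : {in S0 & U, forall a u, e a u}.
  by move=> a u aS uU; apply: eSX; [apply: (subsetP S0S) | apply: (subsetP UX)].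
have nSX a : a \in S -> a \notin X by move/(subsetP SAX); rewrite inE => /andP[].
have dSX : [disjoint S0 & X].
  by rewrite disjoint_subset; apply/subsetP=> a /(subsetP S0S)/nSX.
have dSU : [disjoint S0 & U] by apply: disjointWr dSX.
(* Either [S0] is [S] and [maxS] applies, or the size limit stopped its growth and [U] itself has at
   most [#|S0| + 1] vertices. *)
have boundU w : w \in A -> w \notin X -> w \notin S0 -> deg U w <= #|S0|.+1.
  move=> wA wX wS0; case: (boolP (w \in S)) => wS.
    have := deg_le_card U w; suff : #|U| <= #|S0|.+1 by nlia.
    rewrite leqNgt; apply/negP=> lt; have : #|w |: S0| <= #|S0|.
      by apply: maxS0; rewrite subUset sub1set wS S0S cardsU1 wS0.
    by rewrite cardsU1 wS0 add1n ltnn.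
  have [SS0|/subsetPn[a aS aS0]] := boolP (S \subset S0).
    apply: leq_trans (deg_sub w UX) _; apply: leq_trans (maxS w wA wX wS) _.
    by rewrite ltnS subset_leq_card.
  have := deg_le_card U w; suff : #|U| <= #|S0|.+1 by nlia.
  rewrite leqNgt; apply/negP=> lt; have : #|a |: S0| <= #|S0|.
    by apply: maxS0; rewrite subUset sub1set aS S0S cardsU1 aS0.
  by rewrite cardsU1 aS0 add1n ltnn.
have HA : S0 :|: U \subset A by rewrite subUset S0A (subset_trans UX).
(* For small [k] the walks inside the core suffice. Otherwise [t] has too many neighbours for [S0],
   and since [X] is independent one lies outside the core. *)
have [kS|kS] := leqP k #|S0|.+1.
  have H i : i <= #|S0| -> lengths A X X (1 + 2 * i).
    move=> iS; apply: (lengths_sub HA UX _ (zigzag dSU eSU t1U iS _)).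
      by rewrite sub1set (subsetP UX).
    by move: iS cS0; nlia.
  exists 1, 2; split; first (by right); first exact: (H 0).
  by move=> i ik; apply: H; move: ik kS; nlia.
have [y0 y0D ety] : exists2 y0, y0 \in A :\: (S0 :|: X) & e t y0.
  apply: deg_gt0; have := dA t tA; rewrite /rdeg tX.
  have : deg A t <= deg (S0 :|: X) t + deg (A :\: (S0 :|: X)) t.
    by apply: deg_cover => w wA _; rewrite [in X in _ || X]in_setD wA andbT orbN.
  have := deg_subU t (subxx (S0 :|: X)); have := deg_le_card S0 t.
  by move: kS; rewrite degt; nlia.
have [E [y0E EA clE cE]] := component y0D.
have y0Y : y0 \in nbrs t by rewrite inE.
have [B [Z [hB BE degB [r exitB] alt]]] := end_block cE y0E y0Y.
have EA' := subset_trans EA (subsetDl _ _); have BA := subset_trans BE EA'.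
have nE w : w \in E -> (w \notin S0) && (w \notin X).
  by move/(subsetP EA); rewrite in_setD in_setU negb_or => /andP[].
have nEX w : w \in E -> w \notin X by case/nE/andP.
have tE : t \notin E by apply/negP=> /nEX; rewrite tX.
have dHE : [disjoint S0 :|: U & E].
  rewrite disjoint_sym disjoint_subset; apply/subsetP=> w /nE/andP[wS wX].
  by rewrite inE /= in_setU negb_or wS; apply: contra wX; apply: (subsetP UX).
have dHB : [disjoint S0 :|: U & B] by apply: disjointWr dHE.
have Bn : #|B| < n.
  apply: leq_trans An; apply: proper_card; rewrite properE BA; apply/subsetPn.
  by exists t; rewrite //; apply: contra tE; apply: (subsetP BE).
have adj F c v : c \in F -> F \subset E -> v \in A -> v \notin F ->
    (forall u w, u \in F -> w \in E -> e u w -> w != v -> w \in F) ->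
    (forall u, u \in F -> e u t -> v = t) -> meets F (Nbrs (S0 :|: U)).
  move=> cF FE vA vF ctF ctt; case: (classic (meets F (Nbrs (S0 :|: U)))) => // N.
  have [|[x xF xX] _] := ctA F c v cF (subset_trans FE EA') vA vF; last first.
    by have := nEX x (subsetP FE x xF); rewrite xX.
  move=> u w uF wA euw wv; have [wH|wH] := boolP (w \in S0 :|: U).
    by case: N; exists u => //; apply/NbrsP; exists w; rewrite // sym_e.
  have [Ew|wt] := eqVneq w t; first by case/eqP: wv; rewrite (ctt u uF) -?Ew.
  apply: (ctF u) => //; apply: (clE u); rewrite ?(subsetP FE) // in_setD wA andbT.
  by move: wH; rewrite !in_setU in_setD1 wt.
have adjB : meets B (Nbrs (S0 :|: U)).
  case: alt => [BE'|[b [bE bB ctB _ nBY]]].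
    by apply: (adj B y0 t); rewrite ?BE'.
  have [z zZ] := block_neq0 hB.
  apply: (adj B z b) => //; rewrite ?(subsetP EA') ?(subsetP (block_sub hB)) //.
  by move=> u uB eut; case: nBY; exists u; rewrite // inE sym_e.
have hT w : w \in B -> deg U w <= #|S0|.+1.
  by move=> /(subsetP BE) wE; case/andP: (nE w wE) => wS wX; apply: boundU => //; apply: (subsetP EA').
have nBU w : w \in B -> (w \in U) = false.
  by move=> /(subsetP BE)/nEX wX; apply: contraNF wX; apply: (subsetP UX).
have hX w : w \in B -> deg U w * (w \in U) = 0 /\ deg S0 w + (w \in U) <= #|S0|.
  by move=> /nBU->; rewrite muln0 addn0 deg_le_card.
have hd w : w \in B -> k < deg B w + (deg S0 w + deg U w) + (w \in U) + (w \in Z).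
  move=> wB; have wE := subsetP BE w wB; have := dA w (subsetP BA w wB); have := degB w wB.
  have := deg_component clE wE; have := deg_subU w (subxx (S0 :|: X)).
  have := deg_subU (A := X) (B := U) (C := [set t]) w.
  rewrite setUC setD1K // => /(_ (subxx _)).
  rewrite /rdeg (negPf (nEX w wE)) deg_set1 inE (sym_e t); nlia.
(* With [U] in the place of [X], which [B] avoids, the exceptional outcome cannot occur. *)
case: (good_core IH Bn hB dSU eSU cS0 (subxx U) dHB adjB hT hX hd) => [H|[_ _ _ [w wB wU]]]; last first.
  by rewrite nBU in wU.
apply: (admissible_impl (r := r + 1)) H => l /(exitB _ _ _ dHE)/lengths_end Hl.
have dt : [disjoint S0 :|: U :|: E & [set t]].
  rewrite disjoint_sym disjoints1 !in_setU (negPf tE) orbF negb_or.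
  by rewrite (disjointFl dSX tX) in_setD1 eqxx.
rewrite addnA; apply: lengths_sub (lengths_cat_vertex dt Hl (lengths_self (set11 t) (subxx _))) => //.
  by rewrite !(subUset, sub1set) S0A EA' tA (subset_trans UX).
by rewrite sub1set.
Qed.

(** * Clique cores *)

Definition clique C : Prop := {in C &, forall x y, x != y -> e x y}.

Lemma clique_lengths i C u : clique C -> u \in C -> i < #|C| ->
  lengths C C [set u] (1 + i).
Proof.
elim: i C u => [|i IH] C u cC uC iC; first exact: lengths_self.
have ltC : i < #|C :\ u| by move: iC; rewrite (cardsD1 u C) uC; nlia.
have [w wC] : exists w, w \in C :\ u by apply/card_gt0P; apply: leq_trans ltC.
have cCu : clique (C :\ u) by move=> x y /setD1P[_ xC] /setD1P[_ yC]; apply: cC.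
have [x [_ [xC /set1P-> W]]] := IH _ w cCu wC ltC.
have [wu wC'] := setD1P wC; have [_ xC'] := setD1P xC.
have dCu : [disjoint C :\ u & [set u]] by rewrite disjoint_sym disjoints1 !inE eqxx.
exists x, u; split; rewrite ?set11 // addnS -addn1.
apply: walk_sub (walk_cat dCu W (cC w u wC' uC wu) (walk1 (set11 u))).
by rewrite subUset subsetDl sub1set.
Qed.

(** Outside a maximal clique [C], a vertex has at most [#|C|] edges to [C] and x together. Since
    [#|C|] is at least 2, the allowance [#|C| - 1] also covers a lone edge to x, so no exceptional
    core arises. *)
Lemma good_or_clique n k A X Y x1 x2 :
  induction_hypothesis n -> #|A| <= n -> robust A X Y ->
  (forall v, v \in A -> k < rdeg A X Y v) ->
  x1 \in X -> x2 \in X -> e x1 x2 ->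
  good k A X Y \/ exists C, [/\ C \subset X, clique C, 1 < #|C| & Y \subset C].
Proof.
move=> IH An [rA cA ctA] dA x1X x2X e12; have XA := rooted_subl rA.
have n12 : x1 != x2 by apply: contraTneq e12 => ->; rewrite irr_e.
have P0 : [set x1; x2] \subset X /\ clique [set x1; x2].
  rewrite subUset !sub1set x1X x2X; split=> // x y.
  by move=> /set2P[]-> /set2P[]->; rewrite ?eqxx // sym_e.
have [C [[CX cC] maxC]] := ex_max_card (P := fun C => C \subset X /\ clique C) P0.
have C2 : 1 < #|C| by apply: leq_trans (maxC _ P0); rewrite cards2 n12.
case: (boolP (Y \subset C)) => [YC|/subsetPn[y0 y0Y y0C]]; first by right; exists C.
left; have CA := subset_trans CX XA.
have y0A : y0 \in A :\: C by rewrite inE y0C (subsetP (rooted_subr rA)).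
have [E [y0E EA clE cE]] := component y0A.
have EA' := subset_trans EA (subsetDl _ _).
have nEC w : w \in E -> w \notin C by move/(subsetP EA); rewrite inE => /andP[].
have [c cC'] : exists c, c \in C by apply/card_gt0P; apply: leq_trans C2.
have cE' : c \notin E by apply/negP=> /nEC; rewrite cC'.
have rE : rooted E (Nbrs C :&: E) (Y :&: E).
  apply: (rooted_component EA clE cE y0E y0Y) => [clA|F f v fF FE vA vF ctF].
    by case/negP: cE'; rewrite -(cA E y0) // (subsetP CA).
  by have [] := ctA F f v fF (subset_trans FE EA') vA vF ctF.
have dCE : [disjoint C & E].
  by rewrite disjoint_sym disjoint_subset; apply/subsetP=> w /nEC.
have En : #|E| < n.
  apply: leq_trans An; apply: proper_card; rewrite properE EA'.
  by apply/subsetPn; exists c; rewrite // (subsetP CA).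
have H : admissible k (lengths (C :|: E) X (Y :&: E)).
  apply: (good_attach_rooted (m := #|C|) IH En rE y0E dCE).
    have Hl i : i < #|C| -> forall w, w \in Nbrs C :&: E ->
        exists u, e w u /\ lengths C X [set u] (1 + i).
      move=> iC w /setIP[/NbrsP[u uC euw] _]; exists u; rewrite sym_e; split=> //.
      by apply: lengths_sub (clique_lengths cC uC iC).
    exists 1, 1; split; [by left | by apply: (Hl 0); apply: leq_trans C2 |].
    by move=> i iC; rewrite mul1n; apply: Hl.
  move=> w wE; have := dA w (subsetP EA' w wE); have := deg_component clE wE.
  have : deg C w + (w \in X) <= #|C|.
    have := deg_le_card C w; case: (boolP (w \in X)) => wX; last by rewrite addn0.
    rewrite addn1 leq_eqVlt => /orP[/eqP dC|//].
    have allC u : u \in C -> e u w.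
      move=> uC; have : nbrs w :&: C = C.
        by apply/eqP; rewrite eqEcard subsetIr -/(deg C w) dC /=.
      by move/setP/(_ u); rewrite !inE uC andbT sym_e.
    have : #|w |: C| <= #|C|.
      apply: maxC; rewrite subUset sub1set wX; split=> // x y.
      rewrite !in_setU1 => /orP[/eqP->|xC] /orP[/eqP->|yC]; rewrite ?eqxx //.
      - by rewrite sym_e allC.
      - by rewrite allC.
      - exact: cC.
    by rewrite cardsU1 (nEC w wE) add1n ltnn.
  rewrite /rdeg !in_setI wE !andbT; have := deg_Nbrs C w.
  by move: C2; case: (w \in X); case: (w \in Nbrs C); rewrite /= ?muln0 ?muln1; nlia.
apply: (admissible_impl (r := 0)) H => l; rewrite addn0; apply: lengths_sub => //.
  by rewrite subUset CA.
exact: subsetIl.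
Qed.

(** One vertex [t] of the clique is set aside to end the walks. If nothing lies outside the clique,
    the degrees force [k <= #|X|], and walks inside it suffice. *)
Lemma good_clique_twin n k A X x :
  induction_hypothesis n -> #|A| <= n -> robust A X X ->
  (forall v, v \in A -> k < rdeg A X X v) ->
  clique X -> 1 < #|X| -> x \in X -> good k A X X.
Proof.
move=> IH An [rA cA ctA] dA cX X2 xX; have XA := rooted_subl rA.
have degX v : v \in X -> deg X v <= #|X|.-1.
  move=> vX; apply: leq_trans (_ : deg (X :\ v) v <= _).
    apply: leq_trans (deg_subU (B := X :\ v) (C := [set v]) v _) _.
      by rewrite setUC setD1K.
    by rewrite deg_set1 irr_e addn0.
  by apply: leq_trans (deg_le_card _ _) _; rewrite (cardsD1 v X) vX.
case: (boolP (A \subset X)) => [AX|/subsetPn[u uA uX]].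
  have kX : k <= #|X|.
    have := dA x (subsetP XA x xX); have := deg_sub x AX; have := degX x xX.
    by rewrite /rdeg xX; move: X2; nlia.
  have Hl i : i < #|X| -> lengths A X X (1 + i).
    move=> iX; apply: lengths_sub (clique_lengths cX xX iX) => //.
    by rewrite sub1set.
  exists 1, 1; split; [by left | by apply: (Hl 0); apply: leq_trans X2 |].
  by move=> i ik; rewrite mul1n; apply: Hl; apply: leq_trans kX.
have uAX : u \in A :\: X by rewrite inE uX.
have [E [uE EA clE cE]] := component uAX.
have EA' := subset_trans EA (subsetDl _ _).
have nEX w : w \in E -> w \notin X by move/(subsetP EA); rewrite inE => /andP[].
have [|clA|[w [t [wE /setIP[tA tX] ewt]]]] := closed_or_adj clE (subxx E).
- by move=> v w _ wE _.
- by have := nEX x; rewrite -(cA E u) ?(subsetP XA) // xX => /(_ isT).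
have rE : rooted E (Nbrs (X :\ t) :&: E) (nbrs t :&: E).
  apply: (rooted_component_split EA clE cE tX tA wE ewt) => F f v fF FE vA vF ctF.
  have [[y yF yX] _] := ctA F f v fF (subset_trans FE EA') vA vF ctF.
  by have := nEX y (subsetP FE y yF); rewrite yX.
have dXE : [disjoint X & E].
  by rewrite disjoint_sym disjoint_subset; apply/subsetP=> y /nEX.
have En : #|E| < n.
  apply: leq_trans An; apply: proper_card; rewrite properE EA'.
  by apply/subsetPn; exists x; rewrite ?(subsetP XA) //; apply/negP=> /nEX; rewrite xX.
have cardX : #|X| = #|X :\ t|.+1 by rewrite (cardsD1 t X) tX.
have H : admissible k (lengths (X :\ t :|: E) X (nbrs t :&: E)).
  apply: (good_attach_rooted (m := #|X :\ t|) IH En rE wE).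
    by apply: disjointWl dXE; apply: subsetDl.
    have cXt : clique (X :\ t) by move=> y z /setD1P[_ yX] /setD1P[_ zX]; apply: cX.
    have Hl i : i < #|X :\ t| -> forall w, w \in Nbrs (X :\ t) :&: E ->
        exists u, e w u /\ lengths (X :\ t) X [set u] (1 + i).
      move=> iX v /setIP[/NbrsP[s sX esv] _]; exists s; rewrite sym_e; split=> //.
      by apply: lengths_sub (clique_lengths cXt sX iX) => //; apply: subsetDl.
    exists 1, 1; split; [by left | by apply: (Hl 0); move: X2; rewrite cardX |].
    by move=> i iX; rewrite mul1n; apply: Hl.
  move=> v vE; have := dA v (subsetP EA' v vE); have := deg_component clE vE.
  have := deg_subU (A := X) (B := X :\ t) (C := [set t]) v.
  rewrite setUC setD1K // => /(_ (subxx _)); have := deg_le_card (X :\ t) v.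
  rewrite /rdeg (negPf (nEX v vE)) !in_setI vE !andbT deg_set1 inE (sym_e t).
  have := deg_Nbrs (X :\ t) v; move: X2; rewrite cardX.
  by case: (v \in Nbrs _); rewrite /= ?muln0 ?muln1; nlia.
apply: (admissible_impl (r := 1)) H => l Hl.
have dt : [disjoint X :\ t :|: E & [set t]].
  rewrite disjoint_sym disjoints1 in_setU in_setD1 eqxx /=.
  by apply/negP=> /nEX; rewrite tX.
have st : nbrs t :&: E \subset nbrs t :&: (X :\ t :|: E) by apply/setIS/subsetUr.
have Hl' := lengths_sub (subxx _) (subxx _) st Hl.
apply: lengths_sub (lengths_cat_vertex dt Hl' (lengths_self (set11 t) (subxx _))) => //.
  by rewrite !(subUset, sub1set) EA' tA (subset_trans (subsetDl _ _) XA).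
by rewrite sub1set.
Qed.

Lemma robust_sym A X Y : robust A X Y -> robust A Y X.
Proof.
move=> [rA cA ctA]; split=> //; first exact: rooted_sym.
by move=> C c v cC CA vA vC ctC; have [] := ctA C c v cC CA vA vC ctC.
Qed.

Lemma rdeg_sym A X Y v : rdeg A X Y v = rdeg A Y X v.
Proof. by rewrite /rdeg addnAC. Qed.

(** A clique containing [Y] gives [Y] an edge, because robustness gives y a second neighbour; the
    argument repeats with the roots exchanged and leaves only [X = Y]. *)
Lemma good_clique n k A X Y x1 x2 :
  induction_hypothesis n -> #|A| <= n -> robust A X Y ->
  (forall v, v \in A -> k < rdeg A X Y v) ->
  x1 \in X -> x2 \in X -> e x1 x2 -> good k A X Y.
Proof.
move=> IH An rob dA x1X x2X e12.
have [//|[C [CX cC C2 YC]]] := good_or_clique IH An rob dA x1X x2X e12.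
have [rA cA ctA] := rob; have XA := rooted_subl rA; have x1A := subsetP XA x1 x1X.
have n12 : x1 != x2 by apply: contraTneq e12 => ->; rewrite irr_e.
have [_ [y yA yY]] := rooted_nonempty rA x1A.
have [x xy xX] : exists2 x, x != y & x \in X.
  by have [E|] := eqVneq x1 y; [exists x2; rewrite // -E eq_sym | exists x1].
have [|||||_ [y' y'A y'Y]] := ctA (A :\ y) x y => //.
- by rewrite !inE xy (subsetP XA).
- exact: subsetDl.
- by rewrite !inE eqxx.
- by move=> u w _ wA _ wy; rewrite !inE wy.
have [y'y _] := setD1P y'A.
have ey : e y' y by apply: cC; rewrite ?(subsetP YC).
have dA' v : v \in A -> k < rdeg A Y X v by rewrite rdeg_sym; apply: dA.
have [/good_sym//|[C' [C'Y _ _ XC']]] := good_or_clique IH An (robust_sym rob) dA' y'Y yY ey.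
have XY : X = Y.
  by apply/eqP; rewrite eqEsubset (subset_trans XC') // (subset_trans YC).
have XC : X = C.
  by apply/eqP; rewrite eqEsubset CX XY YC.
rewrite -XY in rob dA *; apply: (good_clique_twin IH An rob dA _ _ x1X); by rewrite XC.
Qed.

(** The core at each root must contain the neighbourhood of the other root; comparing sizes then
    leaves only [X = Y = T]. *)
Lemma good_independent n k A X Y :
  induction_hypothesis n -> #|A| <= n -> 2 < k -> robust A X Y ->
  (forall v, v \in A -> k < rdeg A X Y v) ->
  {in X &, forall x1 x2, ~~ e x1 x2} -> {in Y &, forall y1 y2, ~~ e y1 y2} ->
  (exists x, x \in X) -> (exists y, y \in Y) -> good k A X Y.
Proof.
move=> IH An k2 rob dA indX indY neX neY.
have [//|[S [T [coreX YST]]]] := good_or_bicore IH An k2 rob dA indX neX.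
have dA' v : v \in A -> k < rdeg A Y X v by rewrite rdeg_sym; apply: dA.
have [/good_sym//|[S' [T' [coreY XST']]]] :=
  good_or_bicore IH An k2 (robust_sym rob) dA' indY neY.
(* A root adjacent to the side S sees only S, and then the two cores outgrow each other. *)
have side X1 Y1 S1 T1 S2 T2 : bicore A X1 S1 T1 -> bicore A Y1 S2 T2 ->
    {in Y1 &, forall y1 y2, ~~ e y1 y2} -> Y1 \subset S1 :|: T1 -> X1 \subset S2 :|: T2 ->
    Y1 \subset T1.
  move=> c1 c2 ind1 Y1S X1S; apply/subsetP=> y yY.
  have := subsetP Y1S y yY; rewrite in_setU => /orP[yS|//].
  have Y1S1 : Y1 \subset S1.
    apply/subsetP=> z zY; have := subsetP Y1S z zY; rewrite in_setU => /orP[//|zT].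
    by have := ind1 y z yY zY; rewrite (bicore_complete c1).
  have X1S2 : X1 \subset S2.
    apply/subsetP=> z zX; have := subsetP X1S z zX; rewrite in_setU => /orP[//|zT].
    have := subsetP (bicore_subS c1) z (subsetP Y1S1 z (subsetP (bicore_subT c2) z zT)).
    by rewrite inE zX.
  have := subset_leq_card Y1S1; have := subset_leq_card X1S2.
  have := subset_leq_card (bicore_subT c1); have := subset_leq_card (bicore_subT c2).
  by have := bicore_card c1; have := bicore_card c2; nlia.
have YT := side _ _ _ _ _ _ coreX coreY indY YST XST'.
have XT' := side _ _ _ _ _ _ coreY coreX indX XST' YST.
have YX := subset_trans YT (bicore_subT coreX).
have XY := subset_trans XT' (bicore_subT coreY).
have EXY : X = Y by apply/eqP; rewrite eqEsubset XY.
have ETX : T = X by apply/eqP; rewrite eqEsubset (bicore_subT coreX) {1}EXY YT.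
rewrite -EXY in rob dA *; rewrite ETX in coreX.
exact: good_twin IH An k2 rob dA indX neX coreX.
Qed.

(** * The induction on the number of vertices *)

Lemma rooted_closed_part A X Y C : rooted A X Y -> C \subset A -> closed_in A C ->
  rooted C (X :&: C) (Y :&: C).
Proof.
move=> rA CA clC; split; try exact: subsetIr.
  move=> F c cF FC clF; have [|[x xF xX] [y yF yY]] := rooted_closed rA cF (subset_trans FC CA).
    move=> u w uF wA euw; apply: (clF u) => //; apply: (clC u) => //; exact: (subsetP FC).
  split; [exists x | exists y]; by rewrite // inE (subsetP FC) ?andbT.
move=> F c v cF FC vC vF ctF.
have [|x xF xXY] := rooted_cut rA cF (subset_trans FC CA) (subsetP CA v vC) vF.
  move=> u w uF wA euw; apply: (ctF u) => //; apply: (clC u) => //; exact: (subsetP FC).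
by exists x; rewrite // -setIUl inE xXY (subsetP FC).
Qed.

Theorem good_rooted n : induction_hypothesis n.
Proof.
elim: n => [|n IH] k A X Y An rA [a aA] dA //.
have [k1|k1] := leqP k 1.
  have [[x xA xX] _] := rooted_nonempty rA aA.
  have [y [l [yY W]]] := rooted_walk rA xA.
  by apply: admissible_le k1 _; apply: (admissible1 (l := l)); exists x, y.
have {}dA := dA k1; rewrite ltnS in An.
have small C v : C \subset A -> v \in A -> v \notin C -> #|C| < n.
  move=> CA vA vC; apply: leq_trans An; apply: proper_card; rewrite properE CA.
  by apply/subsetPn; exists v.
case: (classic (connected A)) => [cA|ncA]; last first.
  have [F [x [xF FA clF]]] : exists F x, [/\ x \in F, F \subset A, closed_in A F & A <> F].
    case: (classic (exists F x, [/\ x \in F, F \subset A, closed_in A F & A <> F])) => // N.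
    case: ncA => F x xF FA clF; case: (classic (A = F)) => // AF.
    by case: N; exists F, x.
  move=> AF; have [v vA vF] : exists2 v, v \in A & v \notin F.
    apply/subsetPn; apply/negP=> AF'; apply: AF; apply/eqP; by rewrite eqEsubset AF'.
  have H : good k F (X :&: F) (Y :&: F).
    apply: IH; [exact: small vF | exact: rooted_closed_part rA FA clF | by exists x |].
    move=> _ w wF; have := dA w (subsetP FA w wF); rewrite /rdeg !in_setI wF !andbT.
    have : deg A w <= deg F w + deg set0 w.
      by apply: deg_cover => z zA ewz; rewrite (clF w z).
    by have := deg_le_card set0 w; rewrite cards0; nlia.
  apply: (admissible_impl (r := 0)) H => l; rewrite addn0.
  by apply: lengths_sub; rewrite ?subsetIl.
have half X' Y' : rooted A X' Y' -> (forall v, v \in A -> k < rdeg A X' Y' v) ->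
    good k A X' Y' \/ forall C c v, c \in C -> C \subset A -> v \in A -> v \notin C ->
      cut_in A v C -> meets C Y'.
  move=> rA' dA'; case: (classic (good k A X' Y')) => [|N]; [by left | right].
  move=> C c v cC CA vA vC ctC; case: (classic (meets C Y')) => // nCY; case: N.
  apply: (good_cut_part rA' CA vA vC ctC nCY); apply: IH.
  - exact: small vC.
  - exact: rooted_cut_part rA' cC CA vA vC ctC nCY.
  - by exists c.
  - move=> _ w wC; apply: leq_trans (rdeg_cut_part X' CA vA vC ctC nCY wC).
    by apply: dA'; apply: (subsetP CA).
have dA' v : v \in A -> k < rdeg A Y X v by rewrite rdeg_sym; apply: dA.
have [//|ctY] := half X Y rA dA.
have [/good_sym//|ctX] := half Y X (rooted_sym rA) dA'.
have rob : robust A X Y.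
  split=> // C c v cC CA vA vC ctC; split; [exact: (ctX C c v) | exact: (ctY C c v)].
(* For [k = 2] the result on two paths applies directly; naming a neighbour of [a] as the
   exceptional vertex leaves [a] as an ordinary one. *)
have [k2|k2] := leqP k 2.
  have -> : k = 2 by move: k1 k2; nlia.
  have [w wA eaw] : exists2 w, w \in A & e a w.
    apply: deg_gt0; have := dA a aA; rewrite /rdeg.
    by case: (a \in X); case: (a \in Y); move: k1; nlia.
  apply: (@good2_exceptional _ _ _ _ w (leqnn _)) => //.
    by move=> v vA _; apply: leq_trans (dA v vA); move: k1; nlia.
  by exists a; rewrite //; apply: contraTneq eaw => ->; rewrite irr_e.
have indep X' Y' : robust A X' Y' -> (forall v, v \in A -> k < rdeg A X' Y' v) ->
    good k A X' Y' \/ {in X' &, forall x1 x2, ~~ e x1 x2}.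
  move=> rob' dA''; case: (classic (good k A X' Y')) => [|N]; [by left | right].
  move=> x1 x2 x1X x2X; apply/negP=> e12; apply: N.
  exact: good_clique IH An rob' dA'' x1X x2X e12.
have [//|indX] := indep X Y rob dA.
have [/good_sym//|indY] := indep Y X (robust_sym rob) dA'.
have [[x _ xX] [y _ yY]] := rooted_nonempty rA aA.
by apply: (good_independent IH An k2 rob dA indX indY); [exists x | exists y].
Qed.

End Graph.

(** * Cycles through an edge *)

Lemma rooted_edge (G : sgraph) (x y : G) : two_connected G -> adj x y ->
  let A := ~: [set x; y] in
  rooted (@adj G) A (nbrs (@adj G) x :&: A) (nbrs (@adj G) y :&: A).
Proof.
move=> [_ conn] axy A; have nxy : x != y by apply: contraTneq axy => ->; rewrite adj_irrefl.
have sG := @adj_sym G.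
(* Connectedness after deleting [v]: a set that omits another vertex [u] cannot be left through [v]
   alone. *)
have exit (C : {set G}) c v u : c \in C -> v \notin C -> u \notin C -> u != v ->
    (forall a b, a \in C -> adj a b -> b != v -> b \in C) -> False.
  move=> cC vC uC uv ctC; have [|_ con] := conn [set v]; first by rewrite cards1.
  have cv : c \in ~: [set v] by rewrite !inE; apply: contraNneq vC => <-.
  have uv' : u \in ~: [set v] by rewrite !inE.
  have /connectP[p] := con c u cv uv'.
  elim: p c cC {cv} => [|b p IH] c cC /=; first by move=> _ E; rewrite E cC in uC.
  case/andP=> /and3P[_ bv acb]; apply: IH; apply: (ctC c b cC acb).
  by rewrite !inE in bv.
have inA w : w \in A = (w != x) && (w != y) by rewrite !inE negb_or.
have notA w : w \notin A -> w = x \/ w = y.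
  by rewrite inA negb_and !negbK => /orP[]/eqP->; [left | right].
split; try exact: subsetIr.
- move=> C c cC CA clC.
  have xC : x \notin C by apply/negP=> /(subsetP CA); rewrite inA eqxx.
  have yC : y \notin C by apply/negP=> /(subsetP CA); rewrite inA eqxx andbF.
  have H u v : [set u; v] = [set x; y] -> u != v -> u \notin C -> v \notin C ->
      meets C (nbrs (@adj G) u :&: A).
    move=> uvxy uv uC vC; case: (classic (meets C (nbrs (@adj G) u :&: A))) => // N.
    case: (exit C c v u cC vC uC uv) => a b aC aab bv; case: (boolP (b \in A)) => bA.
      exact: (clC a).
    have: b \in [set u; v] by rewrite uvxy -[_ \in _]negbK -in_setC.
    rewrite !inE (negPf bv) orbF => /eqP Eb; case: N; exists a => //.
    by rewrite inE (subsetP CA) // andbT inE -Eb sG.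
  by split; [apply: (H x y) | apply: (H y x); rewrite // 1?setUC 1?eq_sym].
move=> C c v cC CA vA vC ctC.
have xC : x \notin C by apply/negP=> /(subsetP CA); rewrite inA eqxx.
case: (classic (meets C ((nbrs (@adj G) x :&: A) :|: (nbrs (@adj G) y :&: A)))) => // N.
case: (exit C c v x cC vC xC) => [|a b aC aab bv].
  by move: vA; rewrite inA eq_sym => /andP[].
case: (boolP (b \in A)) => bA; first exact: (ctC a).
case: N; exists a => //; rewrite -setIUl inE (subsetP CA) // andbT !inE.
by case: (notA b bA) => Eb; rewrite Eb in aab; rewrite !(sG _ a) aab ?orbT.
Qed.

Theorem theorem1 (k : nat) (hk : 0 < k) (G : sgraph)
    (hconn : two_connected G) (hdeg : min_degree_geq G (k + 1)) :
  exists C : 'I_k -> seq G,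
    (forall i : 'I_k, is_cycle (C i)) /\
    ((forall i j : 'I_k, j = i + 1 :> nat ->
        #|cycle_edges (C j)| = #|cycle_edges (C i)| + 1) \/
     (forall i j : 'I_k, j = i + 1 :> nat ->
        #|cycle_edges (C j)| = #|cycle_edges (C i)| + 2)).
Proof.
have [x [y axy]] : exists x y : G, adj x y.
  have [G2 _] := hconn; have /card_gt0P[x _] : 0 < #|G| by apply: leq_trans G2.
  have /card_gt0P[y] : 0 < degree x by apply: leq_trans (hdeg x); rewrite addn1.
  by rewrite inE; exists x, y.
have sG := @adj_sym G; pose A := ~: [set x; y].
have nxy : x != y by apply: contraTneq axy => ->; rewrite adj_irrefl.
have rA : rooted (@adj G) A _ _ := rooted_edge hconn axy.
have neA : exists a, a \in A.
  apply/card_gt0P; rewrite cardsCs setCK cards2 nxy subn_gt0; exact: (proj1 hconn).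
have dA v : v \in A -> k < rdeg (@adj G) A (nbrs (@adj G) x :&: A) (nbrs (@adj G) y :&: A) v.
  move=> vA; have := hdeg v; rewrite addn1 /rdeg !in_setI vA !andbT !inE (sG x) (sG y).
  have <- := deg_set1 (@adj G) x v; have <- := deg_set1 (@adj G) y v => h.
  apply: leq_trans h _; rewrite -addnA.
  have -> : degree v = deg (@adj G) setT v by rewrite /deg setIT.
  apply: leq_trans (deg_cover (B := A) (C := [set x; y]) _) _.
    by move=> w _ _; rewrite in_setC orNb.
  by rewrite leq_add2l; apply: deg_subU.
have [a [d [hd _ Hl]]] := good_rooted sG (@adj_irrefl G) (leqnn _) rA neA (fun _ => dA).
have cyc (i : 'I_k) : exists c : seq G, is_cycle c /\ size c = a + d * i + 2.
  have [u [v [uX vY [p [pp up lp sp sz]]]]] := Hl i (ltn_ord i).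
  have xy w : w \in u :: p -> (w != x) && (w != y).
    by move/sp; rewrite !inE negb_or.
  (* Closing the walk through the edge xy adds both roots, whence the [+ 2]. *)
  exists [:: y, x, u & p]; split; last by rewrite /= -sz !addnS addn0.
  move: uX vY; rewrite !inE => /andP[axu _] /andP[ayv _].
  split=> //; rewrite /ucycle /= rcons_path lp pp (sG v) ayv (sG y) axy axu /=.
  rewrite -[(u \notin p) && _]/(uniq (u :: p)) up andbT [y \in _]in_cons negb_or.
  rewrite eq_sym nxy /=; apply/andP; split; apply/negP=> /xy.
    by rewrite eqxx andbF.
  by rewrite eqxx.
have [C hC] := fin_all_exists cyc; exists C; split=> [i|]; first by have [] := hC i.
have cE i : #|cycle_edges (C i)| = a + d * i + 2.
  by have [ci <-] := hC i; rewrite card_cycle_edges.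
by case: hd => Ed; [left | right] => i j ij; rewrite !cE ij Ed; nlia.
Qed.
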